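(* Let $F=(F_1,\dots,F_d)\colon C_+\to C_+$ be the Kolmogorov map $F_i(x)=x_i f_i(x)$, where $f=(f_1,\dots,f_d)\colon C_+\to C_+$ is continuous, $f(x)\gg 0$ for all $x\in C_+$, and $f_i(\mathbf e_i)=1$ for $i=1,\dots,d$. For $\varkappa>0$ put $\Lambda_\varkappa:=[0,(1+\varkappa)\mathbf e]$. Assume that at least one of the following holds: (α) there exists $\varkappa>0$ such that $F{\restriction}_{\Lambda_\varkappa}\colon\Lambda_\varkappa\to F(\Lambda_\varkappa)$ is a local homeomorphism and $F$ is weakly retrotone in $\Lambda_\varkappa$; moreover, for any $x,y\in C_+$ with $x<y$ one has $f_i(x)\ge f_i(y)$ for all $i$, and $f_i(x)>f_i(y)$ for those $i$ for which $x_i<y_i$; (β) for every $\varkappa>0$: $F{\restriction}_{\Lambda_\varkappa}\colon\Lambda_\varkappa\to F(\Lambda_\varkappa)$ is a local homeomorphism, $F$ is weakly retrotone in $\Lambda_\varkappa$, and for any $x,y\in\Lambda_\varkappa$ with $F(x)<F(y)$ one has $f_i(x)\ge f_i(y)$ for all $i$, and, for those $i$ with $F_i(x)<F_i(y)$, either $x_i=0$ or $f_i(x)>f_i(y)$. Then there exists a weak carrying simplex $\Sigma$ for $F$. If, additionally, either there exists $\varkappa>0$ such that $F{\restriction}_{\Lambda_\varkappa}\colon\Lambda_\varkappa\to F(\Lambda_\varkappa)$ is a local homeomorphism and $F$ is retrotone in $\Lambda_\varkappa$, or $f_i(x)>f_i(y)$ for all $i$ whenever $x,y\in C_+$, $x<y$,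 then $\Sigma$ is a carrying simplex. Moreover, with $\Gamma$ denoting the compact attractor of bounded sets, $\Sigma$ satisfies: (vi) $\Sigma$ is the boundary of $\Gamma$ relative to $C_+$, and $\Gamma$ is order convex; in particular $\Gamma=\{\alpha x:\alpha\in[0,1],\ x\in\Sigma\}$. (vii) $\Gamma\setminus\Sigma=\{\alpha x:\alpha\in[0,1),\ x\in\Sigma\}$ is the set of all those $x\in C_+$ that have a backward orbit $\{\dots,x_{-2},x_{-1},x\}$ with $\lim_{n\to\infty}x_{-n}=0$. (viii) $\Sigma$ is the set of all $x\in C_+$ having total orbits that are bounded and bounded away from $0$. (ix) The inverse $(\Pi{\restriction}_\Sigma)^{-1}$ of the orthogonal projection of $\Sigma$ along $\mathbf e$ is Lipschitz continuous.
   Context: Notation: $C_+=\{x\in\mathbb R^d: x_i\ge 0\ \forall i\}$. $\mathbf e_i$ is the $i$-th standard basis vector, $\mathbf e=\sum_i\mathbf e_i$. For $x,y\in C_+$: $x\le y$ if $x_i\le y_i$ for all $i$; $x<y$ if $x\le y$ and $x\ne y$; $x\ll y$ if $x_i<y_i$ for all $i$; $[x,y]=\{z\in C_+:x\le z\le y\}$ for $x\le y$. For $I\subset\{1,\dots,d\}$, $(C_I)_+=\{x\in C_+:x_j=0\ \forall j\notin I\}$; for $x,y\in (C_I)_+$, $x\ll_I y$ means $x_i<y_i$ for all $i\in I$. $B\subset C_+$ is order convex if $x,y\in B$, $x\le y$ imply $[x,y]\subset B$. $\Delta=\{x\in C_+:\sum_i x_i=1\}$; radial projection is $x\mapsto x/\|x\|_1$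 from $C_+\setminus\{0\}$ to $\Delta$. $\Pi u=u-\frac{u\cdot\mathbf e}{d}\mathbf e$ is the orthogonal projection along $\mathbf e$ onto $\mathbf e^\perp$. $\|\cdot\|$ is the Euclidean norm, $\operatorname{dist}(x,A)=\inf_{a\in A}\|x-a\|$. ''$F{\restriction}_\Lambda\colon\Lambda\to F(\Lambda)$ is a local homeomorphism'' means: each $x\in\Lambda$ has a relatively open neighbourhood $U$ in $\Lambda$, and $F(x)$ a relatively open neighbourhood $V$ in $F(\Lambda)$, such that $F{\restriction}_U\colon U\to V$ is a homeomorphism. $F$ is retrotone in $B\subset C_+$ if for all $x,y\in B$ with $F(x)<F(y)$ one has $x_i<y_i$ whenever $y_i>0$. $F$ is weakly retrotone in $B$ if for all $I\subset\{1,\dots,d\}$ and $x,y\in B$: if $F(x)<F(y)$ and $F_i(x)<F_i(y)$ for all $i\in I$, then $x<y$ and $x_i<y_i$ for all $i\in I$. A set $B\subset C_+$ is unordered if no two distinct points of $B$ are related by $<$; it is weakly unordered if for any nonempty $I\subset\{1,\dots,d\}$ no two distinct points of $B\cap (C_I)_+$ are related by $\ll_I$. A backward orbit of $x$ is a set $\{\dots,x_{-2},x_{-1},x_0\}$ with $x_0=x$ and $F(x_{-n-1})=x_{-n}$ for all $n\ge0$; a total orbit of $x$ is the union of a backward orbit and the forward orbit $\{F^n(x):n\ge0\}$. $B$ attracts $A$ if for each $\epsilon>0$ there is $n_0$ with $\operatorname{dist}(F^n(x),B)<\epsilon$ for all $n\ge n_0$, $x\in A$. The compact attractor of bounded sets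 $\Gamma$ is the (unique, if it exists) nonempty compact set $\Gamma\subset C_+$ with $F(\Gamma)=\Gamma$ that attracts every bounded $A\subset C_+$. The carrying simplex [resp. weak carrying simplex] for a Kolmogorov map $F$ is a set $\Sigma\subset C_+$ such that: (i) $\Sigma$ is an unordered [resp. weakly unordered] subset of the compact attractor of bounded sets $\Gamma$; (ii) $\Sigma$ is homeomorphic to $\Delta$ via radial projection; (iii) $F(\Sigma)=\Sigma$ and $F{\restriction}_\Sigma\colon\Sigma\to\Sigma$ is a homeomorphism; (iv) $\Sigma$ attracts any bounded $A\subset C_+$ with $0\notin\bar A$; (v) for any $x\in C_+\setminus\{0\}$ [resp. for any $x\in\Gamma\setminus\{0\}$] there is $y\in\Sigma$ with $\lim_{n\to\infty}\|F^n(x)-F^n(y)\|=0$. *)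

(* Defs.v *)
From HB Require Import structures.
From mathcomp Require Import all_boot all_order all_algebra.
From mathcomp Require Import all_classical all_reals all_analysis.

Set Implicit Arguments.
Unset Strict Implicit.
Unset Printing Implicit Defensive.

Import Order.TTheory GRing.Theory Num.Theory.
Import numFieldNormedType.Exports.

Local Open Scope classical_set_scope.
Local Open Scope ring_scope.

(* Points of R^d are row vectors 'rV[R]_d.  Maps on C_+ are total functions on
   'rV[R]_d of which only the restriction to C_+ is ever used.  The library
   norm on 'rV[R]_d is the sup norm; it induces the usual topology and the
   usual bounded sets, and the Euclidean norm is defined below. *)

Section Order.
Context {R : realType} {d : nat}.
Implicit Types (x y : 'rV[R]_d) (I : {set 'I_d}) (A B : set 'rV[R]_d).

Definition Cplus : set 'rV[R]_d := [set x | forall i, 0 <= x 0 i].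

Definition Cface I : set 'rV[R]_d :=
  [set x | Cplus x /\ forall j, j \notin I -> x 0 j = 0].

Definition vle x y := forall i, x 0 i <= y 0 i.
Definition vlt x y := vle x y /\ x <> y.
Definition vll x y := forall i, x 0 i < y 0 i.
Definition vll_in I x y := forall i, i \in I -> x 0 i < y 0 i.

Definition vitv x y : set 'rV[R]_d := [set z | [/\ Cplus z, vle x z & vle z y]].

Definition order_convex B :=
  forall x y, B x -> B y -> vle x y -> vitv x y `<=` B.

Definition unordered B := forall x y, B x -> B y -> x <> y -> ~ vlt x y.

Definition weakly_unordered B :=
  forall I, I != finset.set0 ->
  forall x y, (B `&` Cface I) x -> (B `&` Cface I) y -> x <> y ->
  ~ vll_in I x y.

End Order.

Section Euclidean.
Context {R : realType} {d : nat}.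
Implicit Types (x y u : 'rV[R]_d) (A : set 'rV[R]_d).

Definition dotv x y : R := \sum_i x 0 i * y 0 i.
Definition enorm x : R := Num.sqrt (dotv x x).
Definition l1norm x : R := \sum_i `|x 0 i|.

Definition ones : 'rV[R]_d := const_mx 1.

Definition edistance x A : R := inf [set enorm (x - a) | a in A].

Definition std_simplex : set 'rV[R]_d :=
  [set x | Cplus x /\ \sum_i x 0 i = 1].

(* At the origin this takes the junk value 0, which is not in [std_simplex]. *)
Definition radial_proj x : 'rV[R]_d := (l1norm x)^-1 *: x.

Definition orth_proj u : 'rV[R]_d := u - (dotv u ones / d%:R) *: ones.

End Euclidean.

Section Topology.
Context {T : topologicalType}.
Implicit Types (f : T -> T) (A B C U V : set T).

Definition rel_open A U := exists2 O : set T, open O & U = O `&` A.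

Definition rel_boundary C A : set T :=
  C `&` closure (C `&` A) `&` closure (C `\` A).

Definition homeo_on A B f :=
  [/\ set_bij A B f,
      {within A, continuous f} &
      exists g : T -> T,
        (forall x, A x -> g (f x) = x) /\ {within B, continuous g}].

Definition local_homeo_on A f :=
  forall x, A x -> exists U V : set T,
    [/\ rel_open A U /\ U x,
        rel_open (f @` A) V /\ V (f x) &
        homeo_on U V f].

End Topology.

Section Dynamics.
Context {R : realType} {d : nat}.
Implicit Types (f F : 'rV[R]_d -> 'rV[R]_d) (A B Gam Sig : set 'rV[R]_d).

Definition kolmogorov f : 'rV[R]_d -> 'rV[R]_d :=
  fun x => \row_i (x 0 i * f x 0 i).

Definition Lam (k : R) : set 'rV[R]_d := vitv 0 ((1 + k) *: ones).

Definition retrotone F B :=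
  forall x y, B x -> B y -> vlt (F x) (F y) ->
  forall i, 0 < y 0 i -> x 0 i < y 0 i.

Definition weakly_retrotone F B :=
  forall (I : {set 'I_d}) x y, B x -> B y ->
  vlt (F x) (F y) -> vll_in I (F x) (F y) ->
  vlt x y /\ vll_in I x y.

Definition attracts F B A :=
  forall eps : R, 0 < eps ->
  exists n0 : nat, forall n x, (n0 <= n)%N -> A x ->
  edistance (iter n F x) B < eps.

Definition compact_attractor F Gam :=
  [/\ Gam !=set0, compact Gam, Gam `<=` Cplus, F @` Gam = Gam &
      forall A, A `<=` Cplus -> bounded_set A -> attracts F Gam A].

(* x_{-n} is encoded as [u n]. *)
Definition backward_orbit F x (u : nat -> 'rV[R]_d) :=
  [/\ u 0%N = x, forall n, Cplus (u n) & forall n, F (u n.+1) = u n].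

Definition total_orbit F x (O : set 'rV[R]_d) :=
  exists2 u, backward_orbit F x u &
    O = range u `|` range (fun n => iter n F x).

Definition bounded_away_from_0 A :=
  exists2 del : R, 0 < del & forall z, A z -> del <= enorm z.

Definition asymptotic F x y :=
  (fun n => enorm (iter n F x - iter n F y)) @ \oo --> (0 : R).

Definition weak_carrying_simplex F Sig :=
  exists Gam : set 'rV[R]_d, compact_attractor F Gam /\
  [/\ weakly_unordered Sig /\ Sig `<=` Gam,
      homeo_on Sig std_simplex radial_proj,
      F @` Sig = Sig /\ homeo_on Sig Sig F,
      forall A, A `<=` Cplus -> bounded_set A -> ~ closure A 0 ->
        attracts F Sig A &
      forall x, Gam x -> x <> 0 -> exists2 y, Sig y & asymptotic F x y].

Definition carrying_simplex F Sig :=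
  exists Gam : set 'rV[R]_d, compact_attractor F Gam /\
  [/\ unordered Sig /\ Sig `<=` Gam,
      homeo_on Sig std_simplex radial_proj,
      F @` Sig = Sig /\ homeo_on Sig Sig F,
      forall A, A `<=` Cplus -> bounded_set A -> ~ closure A 0 ->
        attracts F Sig A &
      forall x, Cplus x -> x <> 0 -> exists2 y, Sig y & asymptotic F x y].

Definition condition_alpha f :=
  (exists2 k : R, 0 < k &
     local_homeo_on (Lam k) (kolmogorov f) /\
     weakly_retrotone (kolmogorov f) (Lam k)) /\
  (forall x y, Cplus x -> Cplus y -> vlt x y ->
     (forall i, f x 0 i >= f y 0 i) /\
     (forall i, x 0 i < y 0 i -> f x 0 i > f y 0 i)).

Definition condition_beta f :=
  forall k : R, 0 < k ->
  [/\ local_homeo_on (Lam k) (kolmogorov f),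
      weakly_retrotone (kolmogorov f) (Lam k) &
      forall x y, Lam k x -> Lam k y ->
        vlt (kolmogorov f x) (kolmogorov f y) ->
        (forall i, f x 0 i >= f y 0 i) /\
        (forall i, kolmogorov f x 0 i < kolmogorov f y 0 i ->
           x 0 i = 0 \/ f x 0 i > f y 0 i)].

Definition strengthening f :=
  (exists2 k : R, 0 < k &
     local_homeo_on (Lam k) (kolmogorov f) /\
     retrotone (kolmogorov f) (Lam k)) \/
  (forall x y, Cplus x -> Cplus y -> vlt x y ->
     forall i, f x 0 i > f y 0 i).

(* The section [g] of [orth_proj] over its image of A is the inverse of the
   restriction of [orth_proj] to A. *)
Definition orth_proj_inv_lipschitz A :=
  exists g : 'rV[R]_d -> 'rV[R]_d,
    (forall x, A x -> g (orth_proj x) = x) /\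
    exists L : R, forall p q, (orth_proj @` A) p -> (orth_proj @` A) q ->
      enorm (g p - g q) <= L * enorm (p - q).

End Dynamics.

(* Main.v *)
(* Write G for the inverse of F.  Near [0, e] it exists and preserves the order
   (a local homeomorphism with F^-1(0) = {0} is injective), and for x <= y the
   ratios G(x)_i / G(y)_i are at most x_i / y_i, strictly so when
   0 < x_i < y_i.  A Poincare-Miranda argument shows that images of order
   intervals [0, x] are downward closed and, relative to C_+, images of
   downward closed open sets are open; hence Gamma, the intersection of the
   sets F^n([0, b e]), is downward closed, and so is the open set D of the points
   of Gamma that G^n brings into a small box at 0.  Put Sigma = Gamma \ D.  If
   x <= y in Gamma and x_i < y_i whenever x_i > 0, the ratios x_i / y_i contract
   along G^n by a uniform factor as long as G^n(x)_i stays away from 0, so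
   G^n(x) -> 0 and x is in D.  Everything else follows: Sigma is weakly
   unordered and meets each ray once, and Sigma is also the intersection of the
   images F^n([0, b e] \ box), whence its attractivity.  For the asymptotic
   phase of x one takes a limit of G^n(s_n), where s_n is the point of Sigma on
   the ray of F^n(x). *)

Require Import Defs.
From HB Require Import structures.
From mathcomp Require Import all_boot all_order all_algebra.
From mathcomp Require Import all_classical all_reals all_analysis.
From mathcomp Require Import lra.

Set Implicit Arguments.
Unset Strict Implicit.
Unset Printing Implicit Defensive.

Import Order.TTheory GRing.Theory Num.Theory.
Import numFieldNormedType.Exports.

Local Open Scope ring_scope.

(** * A cubical Sperner lemma *)

(** Surjectivity is the hard half of inverting [F]: points below [F x] need preimages, also on the
    faces of the orthant. Inverse monotonicity supplies an a priori bound ([F u <= z <= F x] forces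
    [u <= x]), which takes the place of boundary conditions, and a mod 2 Sperner lemma on cubes then
    produces the preimage. Two nested boxes occur because this needs room around [[0, x]]: [F] is
    inverse monotone on the box of side [K = 1 + k], while the box [L], of side [b = 1 + k/2], is
    mapped into itself. The origin repels because strict decay of [f_i] along the axis and
    [f_i(e_i) = 1] give [f_i(0) > 1]. The contraction rests on
    [F_i(x)/F_i(y) = (x_i/y_i)(f_i(x)/f_i(y))]: a monotone ratio that stays away from 0 has one-step
    factors tending to 1, against a uniform factor. For the asymptotic phase, a point of Sigma above
    the orbit keeps the coordinates positive and ratios work. Outside Gamma the candidate lies below
    the orbit and may lose coordinates in the limit; there Sigma has to be unordered. *)

Section Kuhn.
Variable d : nat.
Implicit Types (J : {set 'I_d}) (q : {ffun 'I_d -> nat}).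

Definition shift q J : {ffun 'I_d -> nat} := [ffun i => (q i + (i \in J))%N].

Lemma addF2K (x : 'F_2) : x + x = 0.
Proof. exact: (addrr_pchar2 (pchar_Fp (isT : prime 2))). Qed.

Lemma shift_notin q J i : i \notin J -> shift q J i = q i.
Proof. by move=> /negbTE iJ; rewrite ffunE iJ addn0. Qed.

Lemma shift1D q J j : j \in J -> shift (shift q [set j]) (J :\ j) = shift q J.
Proof.
move=> jJ; apply/ffunP => i; rewrite !ffunE !inE -addnA.
by case: (eqVneq i j) => [->|_] /=; rewrite ?jJ.
Qed.

Lemma shiftC q i j : shift (shift q [set i]) [set j] = shift (shift q [set j]) [set i].
Proof. by apply/ffunP => k; rewrite !ffunE addnAC. Qed.

(** The mod 2 coboundary of cubical cochains: a cube is its lowest corner [q] with its set [J] of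
    directions, and removing [j] from [J] leaves two opposite facets. *)
Definition cobound (psi : {set 'I_d} -> {ffun 'I_d -> nat} -> 'F_2) J q : 'F_2 :=
  \sum_(j in J) (psi (J :\ j) (shift q [set j]) + psi (J :\ j) q).

Lemma sum_sym_F2 J (h : 'I_d -> 'I_d -> 'F_2) : (forall i j, h i j = h j i) ->
  \sum_(j in J) \sum_(i in J :\ j) h j i = 0.
Proof.
move=> hC; rewrite pair_big_dep /= (bigID (fun p : 'I_d * 'I_d => p.1 < p.2)%N) /=.
rewrite [X in _ + X](reindex_inj (h := fun p => (p.2, p.1))) /=; last first.
  by move=> [i j] [i' j'] [-> ->].
set S := (X in X + _); rewrite -[RHS](addF2K S); congr (_ + _); rewrite {}/S.
apply: eq_big => [[i j]|[i j] _] /=; last exact: hC.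
rewrite !inE eq_sym -leqNgt leq_eqVlt.
have [->|ne] := eqVneq j i; first by rewrite ltnn !andbF.
by rewrite val_eqE eq_sym (negbTE ne) /= [(j \in J) && _]andbC.
Qed.

Lemma cobound_cobound psi J q : cobound (cobound psi) J q = 0.
Proof.
pose h (j i : 'I_d) := psi (J :\ j :\ i) (shift (shift q [set j]) [set i])
  + psi (J :\ j :\ i) (shift q [set j])
  + (psi (J :\ j :\ i) (shift q [set i]) + psi (J :\ j :\ i) q).
have <- : \sum_(j in J) \sum_(i in J :\ j) h j i = 0.
  apply: sum_sym_F2.
  move=> i j; rewrite /h shiftC (_ : J :\ i :\ j = J :\ j :\ i); last first.
    by apply/setP => k; rewrite !inE andbCA.
  by rewrite -!addrA; congr (_ + _); rewrite addrCA.
by apply: eq_bigr => j _; rewrite /cobound -big_split.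
Qed.

Variable a : nat -> {ffun 'I_d -> nat} -> 'F_2.

(* The cubical cup product of the coboundaries of a_0, ..., a_(k-1), evaluated
   on the cube spanned at q by the directions in J. *)
Fixpoint cup k J q : 'F_2 :=
  if k is k'.+1 then
    \sum_(j in J) (a k' (shift q J) + a k' (shift q (J :\ j))) * cup k' (J :\ j) q
  else 1.

(** Leibniz rule: adding the null product of [a k (shift q J)] with [cobound (cup k) J q] cancels
    the farther facets. A product of coboundaries is thus a coboundary, which makes its face sums
    telescope. *)
Lemma cupS_cobound k J q : cobound (cup k) J q = 0 ->
  cup k.+1 J q = cobound (fun J q => cup k J q * a k (shift q J)) J q.
Proof.
move=> clo; rewrite -[RHS]addr0 -(mulr0 (a k (shift q J))) -[in RHS]clo /= /cobound.
rewrite mulr_sumr -big_split; apply: eq_bigr => j jJ /=; rewrite shift1D//.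
set x := a k _; set y := a k _; set u := cup _ _ _; set v := cup _ _ _.
by rewrite mulrDl mulrDr [v * x]mulrC [u * y]mulrC [RHS]addrACA addF2K add0r addrC.
Qed.

Lemma cup_closed k J q : cobound (cup k) J q = 0.
Proof.
elim: k J q => [|k IH] J q; first by rewrite /cobound big1// => j _; exact: addF2K.
rewrite -(cobound_cobound (fun J q => cup k J q * a k (shift q J)) J q).
by apply: eq_bigr => j jJ; rewrite !cupS_cobound.
Qed.

Lemma cup_neq0 k J q : cup k J q != 0 ->
  forall m, (m < k)%N -> exists J1 J2, a m (shift q J1) != a m (shift q J2).
Proof.
elim: k J => [//|k IH] J /=; have [/existsP[j /andP[jJ nz]] _ m|] :=
  boolP [exists j, (j \in J) &&
     ((a k (shift q J) + a k (shift q (J :\ j))) * cup k (J :\ j) q != 0)].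
  rewrite ltnS leq_eqVlt => /orP[/eqP->|mk].
    exists J, (J :\ j); apply: contra nz => /eqP->.
    by rewrite addF2K mul0r.
  by apply: (IH (J :\ j)) => //; apply: contra nz => /eqP->; rewrite mulr0.
rewrite negb_exists => /forallP al; rewrite big1 ?eqxx// => j jJ.
by have := al j; rewrite jJ /= negbK => /eqP.
Qed.

Variables (n : nat).
Hypothesis n_gt0 : (0 < n)%N.
Hypothesis a0 : forall (i : 'I_d) q, q i = 0%N -> a i q = 0.
Hypothesis an : forall (i : 'I_d) q, q i = n -> a i q = 1.

(** On such a cube the [j]-th coordinate is constantly [0] or [n], so [a j] is constant and the
    factor coming from its coboundary vanishes. *)
Lemma cup_eq0 k J q (j : 'I_d) : (j < k)%N -> j \notin J -> q j = 0%N \/ q j = n ->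
  cup k J q = 0.
Proof.
move=> + + qj; elim: k J => // k IH J; rewrite ltnS leq_eqVlt => /orP[/eqP jk|jk] jJ /=.
  rewrite big1// => i iJ; rewrite -jk.
  have jJi : j \notin J :\ i by rewrite !inE (negbTE jJ) andbF.
  case: qj => qj; first by rewrite !a0 ?shift_notin// addr0 mul0r.
  by rewrite !an ?shift_notin// addF2K mul0r.
by rewrite big1// => i iJ; rewrite IH ?mulr0// !inE (negbTE jJ) andbF.
Qed.

Definition nat_ffun (p : {ffun 'I_d -> 'I_n.+1}) : {ffun 'I_d -> nat} :=
  [ffun i => p i : nat].

Definition in_face J (p : {ffun 'I_d -> 'I_n.+1}) :=
  [forall i, if i \in J then (p i < n)%N else p i == n :> nat].

Definition face_sum J (g : {ffun 'I_d -> nat} -> 'F_2) : 'F_2 :=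
  \sum_(p | in_face J p) g (nat_ffun p).

(** Interior values occur twice and cancel mod 2, those at the bottom vanish by assumption, and the
    top face remains. *)
Lemma face_sum_telescope J j g : j \in J ->
  (forall q, q j = 0%N -> g q = 0) ->
  face_sum J (fun q => g (shift q [set j]) + g q) = face_sum (J :\ j) g.
Proof.
(* [P] forgets the condition in direction [j], so that the faces for [J] and [J :\ j] become
   [p j < n] and its negation inside [P]. *)
move=> jJ g0; pose P (p : {ffun 'I_d -> 'I_n.+1}) :=
  [forall i, (i != j) ==> if i \in J then (p i < n)%N else p i == n :> nat].
have PJ (p : {ffun 'I_d -> 'I_n.+1}) : in_face J p = P p && (p j < n)%N.
  apply/forallP/andP => [al|[/forallP al qj] i].
    by split; [apply/forallP => i; apply/implyP => _|move: (al j); rewrite jJ].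
  have [->|ij] := eqVneq i j; first by rewrite jJ.
  by move/implyP: (al i); apply.
have PJj (p : {ffun 'I_d -> 'I_n.+1}) : in_face (J :\ j) p = P p && ~~ (p j < n)%N.
  apply/forallP/andP => [al|[/forallP al qj] i].
    split; first by apply/forallP => i; apply/implyP => ij; move: (al i); rewrite !inE ij.
    by move: (al j); rewrite !inE eqxx /= => /eqP->; rewrite ltnn.
  rewrite !inE; have [->|ij] /= := eqVneq i j.
    by rewrite eqn_leq -(leqNgt n) in qj *; rewrite qj -ltnS ltn_ord.
  by move/implyP: (al i); apply.
rewrite /face_sum big_split /=.
under eq_bigl do rewrite PJ.
under [X in _ + X = _]eq_bigl do rewrite PJ.
under [RHS]eq_bigl do rewrite PJj.
have split (b : {ffun 'I_d -> 'I_n.+1} -> bool) : \sum_(p | P p) g (nat_ffun p) =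
    \sum_(p | P p && b p) g (nat_ffun p) + \sum_(p | P p && ~~ b p) g (nat_ffun p).
  exact: bigID.
have e1 := split (fun p => (p j < n)%N); have e2 := split (fun p => (0 < p j)%N).
rewrite [X in _ + X]big1 ?addr0 in e2; last first.
  by move=> p /andP[_]; rewrite -eqn0Ngt => /eqP qj; rewrite g0// ffunE.
(* Translations by one in direction [j]; [inord] makes them total, and the cases out of range are
   discarded below. *)
pose up (p : {ffun 'I_d -> 'I_n.+1}) : {ffun 'I_d -> 'I_n.+1} :=
  [ffun i => if i == j then inord (p i).+1 else p i].
pose dn (p : {ffun 'I_d -> 'I_n.+1}) : {ffun 'I_d -> 'I_n.+1} :=
  [ffun i => if i == j then inord (p i).-1 else p i].
have e3 : \sum_(p | P p && (0 < p j)%N) g (nat_ffun p) =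
          \sum_(p | P p && (p j < n)%N) g (shift (nat_ffun p) [set j]).
  rewrite (reindex_onto up dn) /=; last first.
    move=> p /andP[_ qj]; apply/ffunP => i; rewrite !ffunE.
    case: (eqVneq i j) => [->|//]; apply/val_inj => /=.
    have le : ((p j).-1 < n.+1)%N by rewrite (leq_ltn_trans (leq_pred _)).
    by rewrite (inordK le) prednK// inordK.
  apply: eq_big => p.
    have PE : (p j < n)%N -> P (up p) = P p.
      move=> _; apply: eq_forallb => i; rewrite ffunE.
      by case: (eqVneq i j).
    rewrite ffunE eqxx; case: (ltnP (p j) n) => qj; last first.
      have qn : p j = n :> nat by apply/eqP; rewrite eqn_leq qj -ltnS ltn_ord.
      rewrite andbF; apply/negP => /andP[/andP[_ pos]] /eqP /ffunP /(_ j).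
      rewrite !ffunE eqxx => /(congr1 val) /=.
      have le : ((inord (p j).+1 : 'I_n.+1).-1 < n.+1)%N.
        by rewrite (leq_ltn_trans (leq_pred _)).
      rewrite (inordK le) qn => e.
      have : ((inord n.+1 : 'I_n.+1) <= n)%N by rewrite -ltnS.
      by rewrite qn in pos; rewrite -(prednK pos) e ltnn.
    rewrite PE// inordK ?ltnS// andbT /=.
    rewrite (_ : dn (up p) == p) ?andbT//; apply/eqP/ffunP => i; rewrite !ffunE.
    by case: (eqVneq i j) => [->|//]; apply/val_inj; rewrite /= !inordK// ltnS// ltnW.
  move=> /andP[/andP[_ _] /eqP qE]; congr (g _); apply/ffunP => i; rewrite !ffunE inE.
  have [->|] := eqVneq i j; last by rewrite addn0.
  have := congr1 (fun p : {ffun 'I_d -> 'I_n.+1} => val (p j)) qE.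
  rewrite /= !ffunE eqxx => qE'.
  case: (ltnP (p j) n) => qj; first by rewrite inordK ?ltnS// addn1.
  have qn : p j = n :> nat by apply/eqP; rewrite eqn_leq qj -ltnS ltn_ord.
  move: qE'.
  have le : ((inord (p j).+1 : 'I_n.+1).-1 < n.+1)%N.
    by rewrite (leq_ltn_trans (leq_pred _)).
  rewrite (inordK le) qn => e.
  have := ltn_ord (inord n.+1 : 'I_n.+1); rewrite ltnS.
  by case: (nat_of_ord _) e => [/= e|m /= ->]; [move: n_gt0; rewrite -e|rewrite ltnn].
rewrite -e3 -e2 e1 addrAC addF2K add0r; apply: eq_bigl => p; by [].
Qed.

(** Stokes and induction: once [cup] is written as a coboundary, only the top face in direction [k]
    survives, where [a k] is 1 and the induction hypothesis applies. In a direction [j < k] the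
    cochain vanishes at both ends, [a j] being constant there. *)
Lemma face_sum_cup k : (k <= d)%N ->
  face_sum [set i : 'I_d | (i < k)%N] (cup k [set i : 'I_d | (i < k)%N]) = 1.
Proof.
elim: k => [_|k IH kd].
  rewrite /face_sum (big_pred1 [ffun=> ord_max])// => p /=.
  apply/forallP/eqP => [al|-> i]; last by rewrite inE ffunE /= eqxx.
  by apply/ffunP => i; rewrite ffunE; apply: val_inj; move: (al i); rewrite inE /= => /eqP.
have := IH (ltnW kd); set Jk := [set i : 'I_d | (i < k)%N]; set J := [set i | _].
pose kk := Ordinal kd.
have JkE : J :\ kk = Jk.
  by apply/setP => i; rewrite !inE ltnS [(i <= k)%N]leq_eqVlt -val_eqE /=; case: ltngtP.
have kJ : kk \in J by rewrite inE.
move=> <-; pose g j q := cup k (J :\ j) q * a k (shift q (J :\ j)).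
transitivity (\sum_(j in J) face_sum J (fun q => g j (shift q [set j]) + g j q)).
  rewrite /face_sum [RHS]exchange_big; apply: eq_bigr => p _.
  by rewrite cupS_cobound//; exact: cup_closed.
rewrite (eq_bigr (fun j => face_sum (J :\ j) (g j))) => [|j jJ]; last first.
  apply: face_sum_telescope => // q qj; rewrite /g.
  move: qj; have [->|jk] := eqVneq j kk => qj.
    by rewrite (a0 (i := kk)) ?mulr0// shift_notin// !inE eqxx.
  rewrite (@cup_eq0 _ _ _ j) ?mul0r ?inE ?eqxx//; last by left.
  by move: jJ; rewrite inE ltnS leq_eqVlt -[X in X || _]/(j == kk) (negbTE jk).
rewrite (bigD1 kk)//= big1 ?addr0 => [|j /andP[jJ jk]].
  rewrite JkE; apply: eq_bigr => p /forallP /(_ kk) pk; rewrite /g JkE (an (i := kk)) ?mulr1//.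
  by rewrite shift_notin ?inE ?ltnn// ffunE; move: pk; rewrite inE ltnn => /eqP.
rewrite /face_sum big1// => p /forallP /(_ j); rewrite !inE eqxx /= => /eqP qj.
rewrite /g (@cup_eq0 _ _ _ j) ?mul0r ?inE ?eqxx//; last by right; rewrite ffunE.
by move: jJ; rewrite inE ltnS leq_eqVlt -[X in X || _]/(j == kk) (negbTE jk).
Qed.

End Kuhn.

(** The product of all [d] coboundaries sums to 1 over the cubes, so it is nonzero on some cube,
    where no label can be constant. *)
Lemma kuhn_cube d n (l : {ffun 'I_d -> nat} -> 'I_d -> bool) : (0 < n)%N ->
  (forall (q : {ffun 'I_d -> nat}) i, q i = 0%N -> l q i = false) ->
  (forall (q : {ffun 'I_d -> nat}) i, q i = n -> l q i) ->
  exists2 q : {ffun 'I_d -> nat}, (forall i, (q i < n)%N) &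
    forall i, (exists J, l (shift q J) i) /\ (exists J, ~~ l (shift q J) i).
Proof.
move=> n0 l0 ln.
pose a k (q : {ffun 'I_d -> nat}) : 'F_2 := if insub k is Some i then (l q i)%:R else 0.
have aE (i : 'I_d) (q : {ffun 'I_d -> nat}) : a i q = (l q i)%:R by rewrite /a valK.
have a0 (i : 'I_d) (q : {ffun 'I_d -> nat}) : q i = 0%N -> a i q = 0 by move=> /l0 e; rewrite aE e.
have an (i : 'I_d) (q : {ffun 'I_d -> nat}) : q i = n -> a i q = 1 by move=> /ln e; rewrite aE e.
have := face_sum_cup n0 a0 an (leqnn d); set J := [set i : 'I_d | _].
have [/existsP[q /andP[/forallP qJ nz]] _|] := boolP
  [exists q : {ffun 'I_d -> 'I_n.+1}, in_face J q && (cup a d J (nat_ffun q) != 0)].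
  exists (nat_ffun q) => i; first by rewrite ffunE; move: (qJ i); rewrite inE ltn_ord.
  have [J1 [J2]] := cup_neq0 nz (ltn_ord i); rewrite !aE.
  case: (boolP (l (shift _ J1) i)) => l1; case: (boolP (l (shift _ J2) i)) => l2 //.
    by split; [exists J1|exists J2].
  by split; [exists J2|exists J1].
rewrite negb_exists => /forallP al; rewrite /face_sum big1 => [/esym/eqP|q qJ].
  by rewrite oner_eq0.
by move: (al q); rewrite qJ /= negbK => /eqP.
Qed.

Local Open Scope classical_set_scope.

(** * Sequences, norms and compactness *)

Section Sequences.
Context {R : realType} {d : nat}.
Implicit Types (u v : nat -> 'rV[R]_d) (x y p q : 'rV[R]_d) (A B : set 'rV[R]_d).

Lemma cvg_rowP u p :
  u @ \oo --> p <-> forall i, (fun n => u n 0 i) @ \oo --> p 0 i.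
Proof.
split=> [up i|up]; first exact: (cvg_comp _ _ up (@coord_continuous _ _ _ 0 i p)).
apply/cvgrPdist_lt => e e0.
have e20 : 0 < e / 2 by lra.
have : \forall n \near \oo, forall i, `|p 0 i - u n 0 i| < e / 2.
  apply: filter_forall => i; move/cvgrPdist_lt : (up i); exact.
apply: filterS => n al; apply: (@le_lt_trans _ _ (e / 2)); last by lra.
rewrite /Num.norm /= mx_normrE; apply: bigmax_le => [|[k i] _]; first exact: ltW.
by rewrite !mxE /= (ord1 k) ltW.
Qed.

(** Subsequences are encoded by [n <= phi n] instead of strict monotonicity: this suffices for
    limits and comes directly from choice. *)
Lemma cvg_subseq (T : topologicalType) (u : nat -> T) (p : T) (phi : nat -> nat) :
  (forall n, (n <= phi n)%N) -> u @ \oo --> p -> (u \o phi) @ \oo --> p.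
Proof.
move=> le up; apply: cvg_comp up; apply/cvgnyPge => N.
by exists N => // n /= Nn; rewrite (leq_trans Nn).
Qed.

Lemma seq_compact A u : compact A -> (forall n, A (u n)) ->
  exists p phi, [/\ A p, forall n, (n <= phi n)%N & (u \o phi) @ \oo --> p].
Proof.
move=> cA uA; have uA' : (u @ \oo) A by exists 0%N => // n _; exact: uA.
have [p [Ap clp]] := cA _ (fmap_proper_filter u _) uA'.
have ex n : exists m, (n <= m)%N /\ `|p - u m| < n.+1%:R^-1.
  have [] := clp [set x | exists2 m, (n <= m)%N & x = u m] (ball p n.+1%:R^-1).
  - by exists n => // m /= nm; exists m.
  - by apply: nbhsx_ballx; rewrite invr_gt0 ltr0n.
  by move=> x [[m nm ->]]; rewrite -ball_normE => ?; exists m.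
have [phi phiP] := choice ex; exists p, phi; split => // [n|]; first by case: (phiP n).
apply/cvgrPdist_lt => e e0.
have [N _ NP] := near_infty_natSinv_lt (PosNum e0).
by exists N => // n /NP /= lt; apply: lt_trans lt; case: (phiP n).
Qed.

Lemma seq_continuous (T U : topologicalType) (D : set T) (f : T -> U) (u : nat -> T) (p : T) :
  {within D, continuous f} -> (forall n, D (u n)) -> D p -> u @ \oo --> p ->
  (f \o u) @ \oo --> f p.
Proof.
move=> /subspace_continuousP cf Du Dp up; apply: (@cvg_comp _ _ _ u f _ (within D (nbhs p))).
  by move=> S /up [N _ NS]; exists N => // n /NS; exact.
exact: cf.
Qed.

Lemma within_continuous_seq A (g : 'rV[R]_d -> 'rV[R]_d) :
  (forall u p, (forall n, A (u n)) -> A p -> u @ \oo --> p -> (g \o u) @ \oo --> g p) ->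
  {within A, continuous g}.
Proof.
move=> sc; apply/subspace_continuousP => x Ax; apply/cvgrPdist_lt => e e0.
apply: contrapT => nn.
have ex (n : nat) : exists y, [/\ A y, `|x - y| < n.+1%:R^-1 & e <= `|g x - g y|].
  apply: contrapT => ny; apply: nn.
  have : nbhs x (ball x (n.+1%:R^-1 : R)) by apply: nbhsx_ballx; rewrite invr_gt0 ltr0n.
  rewrite /prop_near1 /= /within /=; apply: filterS => y; rewrite -ball_normE /= => xy Ay.
  by rewrite ltNge; apply/negP => gy; apply: ny; exists y.
have [u uP] := choice ex.
have ux : u @ \oo --> x.
  apply/cvgrPdist_lt => r r0; have [N _ NP] := near_infty_natSinv_lt (PosNum r0).
  by exists N => // n /NP /= lt; apply: lt_trans lt; case: (uP n).
have /cvgrPdist_lt/(_ e e0)[N _ NP] := sc u x (fun n => let: And3 h _ _ := uP n in h) Ax ux.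
by have := NP N (leqnn N); rewrite /= ltNge; case: (uP N) => _ _ ->.
Qed.

Lemma cvg_in_compact A u p : compact A -> (forall n, A (u n)) -> u @ \oo --> p -> A p.
Proof.
move=> cA uA up; apply: (@closed_cvg _ _ _ _ u A _ _ p up); last by exists 0%N => // n _; exact: uA.
by apply: compact_closed => //; exact: norm_hausdorff.
Qed.

(** Continuity of the inverse: preimages staying away from [x] would have a cluster point, which
    injectivity identifies with [x]. *)
Lemma homeo_on_compact A (g : 'rV[R]_d -> 'rV[R]_d) : compact A -> {within A, continuous g} ->
  (forall x y, A x -> A y -> g x = g y -> x = y) -> homeo_on A (g @` A) g.
Proof.
move=> cA cg gi; split=> //.
  split; [by move=> x; exact: imageP|by move=> x y /set_mem Ax /set_mem Ay; exact: gi|by []].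
pose h y := xget 0 [set x | A x /\ g x = y].
have hP x : A x -> A (h (g x)) /\ g (h (g x)) = g x 
  by move=> Ax; apply: (@xgetPex _ 0 [set z | A z /\ g z = g x]); exists x.
have hK x : A x -> h (g x) = x by move=> Ax; have [Ah] := hP x Ax; exact: gi.
exists h; split=> //; apply: within_continuous_seq => u p uA [x Ax <-] ux.
rewrite hK//.
have Ah n : A (h (u n)) by have [z Az <-] := uA n; rewrite hK.
have gh n : g (h (u n)) = u n by have [z Az <-] := uA n; rewrite hK.
apply/cvgrPdist_lt => e e0; apply: contrapT => nn.
have ex n : exists m, (n <= m)%N /\ e <= `|x - h (u m)|.
  apply: contrapT => nm; apply: nn; exists n => // m /= le.
  by rewrite ltNge; apply/negP => ?; apply: nm; exists m.
have [phi phiP] := choice ex.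
have [y [psi [Ay psiP hy]]] := seq_compact (u := h \o u \o phi) cA (fun n => Ah _).
have := seq_continuous cg (fun n => Ah (phi (psi n))) Ay hy.
rewrite (_ : g \o _ = u \o (phi \o psi)); last by apply/funext => n /=; rewrite gh.
move=> gy; have ugx : u \o (phi \o psi) @ \oo --> g x.
  apply: cvg_subseq ux => n /=; rewrite (leq_trans (psiP n))//.
  by case: (phiP (psi n)).
have /gi : g y = g x by apply: cvg_unique gy ugx; exact: norm_hausdorff.
move=> /(_ Ay Ax) yx; move/cvgrPdist_lt : hy => /(_ e e0) [N _ /(_ N (leqnn N))] /=.
by rewrite yx ltNge; case: (phiP (psi N)) => _ ->.
Qed.

End Sequences.

Section Norms.
Context {R : realType} {d : nat}.
Implicit Types (x y : 'rV[R]_d) (A : set 'rV[R]_d).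

Lemma enorm_ge0 x : 0 <= enorm x.
Proof. exact: sqrtr_ge0. Qed.

Lemma normr_coord_le_enorm x i : `|x 0 i| <= enorm x.
Proof.
rewrite -sqrtr_sqr ler_wsqrtr// /dotv (bigD1 i)//= -expr2 lerDl.
by apply: sumr_ge0 => j _; rewrite -expr2 sqr_ge0.
Qed.

Lemma enorm_le_sum x : enorm x <= \sum_i `|x 0 i|.
Proof.
have s0 : 0 <= \sum_i `|x 0 i| by apply: sumr_ge0.
rewrite -[leRHS]ger0_norm// -sqrtr_sqr ler_wsqrtr// /dotv expr2 mulr_suml.
apply: ler_sum => i _; apply: (@le_trans _ _ (`|x 0 i| * `|x 0 i|)).
  by rewrite -normrM ler_norm.
by rewrite ler_wpM2l// (bigD1 i)//= lerDl sumr_ge0.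
Qed.

Lemma enorm_le x e : (forall i, `|x 0 i| <= e) -> enorm x <= d%:R * e.
Proof.
move=> xe; apply: le_trans (enorm_le_sum x) _.
apply: le_trans (ler_sum _ (fun i _ => xe i)) _.
by rewrite sumr_const card_ord mulr_natl.
Qed.

Lemma normr_coord_le x i : `|x 0 i| <= `|x|.
Proof.
rewrite [leRHS]/Num.norm /= mx_normrE.
exact: (le_bigmax 0 (fun ij : 'I_1 * 'I_d => `|x ij.1 ij.2|) (0, i)).
Qed.

Lemma normr_le_coord x e : 0 <= e -> (forall i, `|x 0 i| <= e) -> `|x| <= e.
Proof.
move=> e0 xe; rewrite [leLHS]/Num.norm /= mx_normrE.
by apply: bigmax_le => // -[k i] _; rewrite /= (ord1 k).
Qed.

Lemma edistance_lt x A a e : A a -> enorm (x - a) < e -> edistance x A < e.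
Proof.
move=> Aa; apply: le_lt_trans; apply: ge_inf; last by exists a.
by exists 0 => _ [b _ <-]; exact: enorm_ge0.
Qed.

Lemma edistance_ltP x A e : A !=set0 -> edistance x A < e ->
  exists2 a, A a & enorm (x - a) < e.
Proof.
move=> [a0 Aa0] lt.
have hE : has_inf [set enorm (x - a) | a in A].
  by split; [exists (enorm (x - a0)), a0|exists 0 => _ [b _ <-]; exact: enorm_ge0].
have e0 : 0 < e - edistance x A by rewrite subr_gt0.
have [_ [a Aa <-] ae] := inf_adherent e0 hE.
by exists a => //; apply: lt_le_trans ae _; rewrite /edistance addrC subrK.
Qed.

End Norms.

(** * Local homeomorphisms and Kolmogorov maps *)

Section Injectivity.
Context {R : realType} {d : nat}.

Lemma seq_closed (V : pseudoMetricNormedZmodType R) (A : set V) :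
  (forall (u : nat -> V) p, (forall n, A (u n)) -> u @ \oo --> p -> A p) -> closed A.
Proof.
move=> sc p clp.
have ex (n : nat) : exists y, A y /\ `|p - y| < n.+1%:R^-1.
  have [] := clp (ball p (n.+1%:R^-1)); first by apply: nbhsx_ballx; rewrite invr_gt0 ltr0n.
  by move=> y []; rewrite -ball_normE; exists y.
have [u uP] := choice ex; apply: (sc u) => [n|]; first by case: (uP n).
apply/cvgrPdist_lt => e e0; have [N _ NP] := near_infty_natSinv_lt (PosNum e0).
by exists N => // n /NP /= lt; apply: lt_trans lt; case: (uP n).
Qed.

Lemma unit_segment_connected (P : R -> Prop) : P 0 ->
  (forall u t, (forall n, 0 <= u n <= 1 /\ P (u n)) -> u @ \oo --> t -> P t) ->
  (forall u t, (forall n, 0 <= u n <= 1 /\ ~ P (u n)) -> u @ \oo --> t -> ~ P t) ->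
  forall t, 0 <= t <= 1 -> P t.
Proof.
move=> P0 Pc nPc.
pose A : set R := [set t | 0 <= t <= 1].
have clA : closed A.
  apply: seq_closed => u p uA up; apply/andP; split.
    by apply: (cvgr_to_ge up); exists 0%N => // n _; case/andP: (uA n).
  by apply: (cvgr_to_le up); exists 0%N => // n _; case/andP: (uA n).
have conA : connected A.
  apply/connected_intervalP => x y /andP[x0 _] /andP[_ y1] z /andP[xz zy].
  by apply/andP; split; [exact: le_trans xz|exact: le_trans zy y1].
have clP : closed (A `&` P).
  apply: seq_closed => u p uA up; split.
    by apply: (@closed_cvg _ _ _ _ u A clA _ p up); exists 0%N => // n _; case: (uA n).
  by apply: (Pc u) => // n; have [] := uA n.
have clN : closed (A `&` ~` P).
  apply: seq_closed => u p uA up; split.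
    by apply: (@closed_cvg _ _ _ _ u A clA _ p up); exists 0%N => // n _; case: (uA n).
  by apply: (nPc u) => // n; have [] := uA n.
have /(_ (A `&` P)) e := conA.
suff eA : A `&` P = A by move=> t t01; have : A t by []; rewrite -eA => -[].
apply: e; first by exists 0; split=> //; rewrite /A /= lexx ler01.
- exists (~` (A `&` ~` P)); first exact: closed_openC.
  apply/seteqP; split=> t /= [At Pt]; split=> //; first by case.
  by apply: contrapT => nPt; apply: Pt.
- by exists (A `&` P) => //; rewrite setIA setIid.
Qed.

Variables (A : set 'rV[R]_d) (F : 'rV[R]_d -> 'rV[R]_d).
Hypothesis A_compact : compact A.
Hypothesis F_cont : {within A, continuous F}.
Hypothesis F_loc : local_homeo_on A F.

(** The shift by [N] discards the terms outside the neighbourhood on which the local inverse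
    lives. *)
Lemma local_homeo_lift (y : nat -> 'rV[R]_d) x : A x ->
  (forall n, (F @` A) (y n)) -> y @ \oo --> F x ->
  exists N z, (forall n, A (z n) /\ F (z n) = y (n + N)%N) /\ z @ \oo --> x.
Proof.
move=> Ax yA yx; have [U [V [ [ [Q oQ UE] Ux] [ [Q' oQ' VE] Vx] [ [FU _ Fs] _ [g [gK gc]]]]]] := F_loc Ax.
have [N _ NP] : \forall n \near \oo, Q' (y n).
  by apply: yx; apply: open_nbhs_nbhs; split => //; move: Vx; rewrite VE; case.
have yV n : V (y (n + N)%N).
  by rewrite VE; split; [apply: NP; rewrite /= leq_addl|exact: yA].
have gU n : U (g (y (n + N)%N)) /\ F (g (y (n + N)%N)) = y (n + N)%N.
  by have [w Uw <-] := Fs _ (yV n); rewrite gK.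
exists N, (fun n => g (y (n + N)%N)); split.
  by move=> n; have [gUn ->] := gU n; split => //; move: gUn; rewrite UE; case.
rewrite -[X in _ --> X](gK x)//.
apply: (seq_continuous (u := fun n => y (n + N)%N) gc) => //.
by apply: (cvg_subseq (phi := fun n => (n + N)%N) _ yx) => n; rewrite leq_addr.
Qed.

(** The set of [t] for which the fibre over [F (t *: x)] is a single point is clopen in the unit
    segment: distinct points of a fibre persist under local lifts, and pairs that merge in the limit
    contradict local injectivity. It contains 0 by the assumption on the fibre of [F 0]. *)
Lemma local_homeo_inj :
  (forall x (t : R), A x -> 0 <= t <= 1 -> A (t *: x)) ->
  (forall x, A x -> F x = F 0 -> x = 0) ->
  forall x y, A x -> A y -> F x = F y -> x = y.
Proof.
move=> star F0 x y Ax Ay Fxy.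
pose P t := forall x1 x2, A x1 -> A x2 -> F x1 = F (t *: x) -> F x2 = F (t *: x) -> x1 = x2.
have cvgZ' (u : nat -> R) (t : R) : u @ \oo --> t -> (fun n => u n *: x) @ \oo --> t *: x.
  by move=> ut; apply: cvgZr_tmp.
have star' (u : nat -> R) (t : R) : (forall n, 0 <= u n <= 1) -> u @ \oo --> t -> 0 <= t <= 1.
  move=> u01 ut; apply/andP; split.
    by apply: (cvgr_to_ge ut); exists 0%N => // n _; case/andP: (u01 n).
  by apply: (cvgr_to_le ut); exists 0%N => // n _; case/andP: (u01 n).
suff /(_ 1) P1 : forall t : R, 0 <= t <= 1 -> P t.
  by apply: P1; rewrite ?lexx ?ler01 ?scale1r.
apply: unit_segment_connected.
- by move=> x1 x2 A1 A2; rewrite scale0r => /(F0 _ A1)-> /(F0 _ A2)->.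
- move=> u t uP ut x1 x2 A1 A2 F1 F2.
  have tA : A (t *: x) by apply: star => //; apply: (star' u) => // n; case: (uP n).
  have uA n : A (u n *: x) by apply: star => //; case: (uP n).
  have Fu : (fun n => F (u n *: x)) @ \oo --> F (t *: x).
    exact: (seq_continuous F_cont uA tA (cvgZ' _ _ ut)).
  have FA n : (F @` A) (F (u n *: x)) by exists (u n *: x).
  have Fu1 : (fun n => F (u n *: x)) @ \oo --> F x1 by rewrite F1.
  have Fu2 : (fun n => F (u n *: x)) @ \oo --> F x2 by rewrite F2.
  have [N1 [z1 [z1P z1x]]] := local_homeo_lift A1 FA Fu1.
  have [N2 [z2 [z2P z2x]]] := local_homeo_lift A2 FA Fu2.
  (* Each lift is re-indexed by the shift of the other, so that both sit over the same point. *)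
  have z1x' : (fun n => z1 (n + N2)%N) @ \oo --> x1.
    by apply: (cvg_subseq (phi := fun n => (n + N2)%N) _ z1x) => n; rewrite leq_addr.
  have z2x' : (fun n => z2 (n + N1)%N) @ \oo --> x2.
    by apply: (cvg_subseq (phi := fun n => (n + N1)%N) _ z2x) => n; rewrite leq_addr.
  apply: (cvg_unique (@norm_hausdorff _ _) z1x'); rewrite (_ : (fun n => _) = (fun n => z2 (n + N1)%N))//.
  apply/funext => n; have [a1 e1] := z1P (n + N2)%N; have [a2 e2] := z2P (n + N1)%N.
  have [_ Pn] := uP (n + N2 + N1)%N; apply: Pn => //.
  by rewrite e2 addnAC.
- move=> u t uP ut Pt.
  have tA : A (t *: x) by apply: star => //; apply: (star' u) => // n; case: (uP n).
  have uA n : A (u n *: x) by apply: star => //; case: (uP n).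
  have ex n : exists w : 'rV[R]_d * 'rV[R]_d,
      [/\ A w.1, A w.2, F w.1 = F (u n *: x), F w.2 = F (u n *: x) & w.1 <> w.2].
    apply: contrapT => nw; have [_ nP] := uP n; apply: nP => x1 x2 A1 A2 F1 F2.
    by apply: contrapT => ne; apply: nw; exists (x1, x2).
  have [w wP] := choice ex.
  have w1A n : A (w n).1 by case: (wP n).
  have [p1 [phi [Ap1 phiP w1p]]] := seq_compact A_compact w1A.
  have w2A n : A (w (phi n)).2 by case: (wP (phi n)).
  have [p2 [psi [Ap2 psiP w2p]]] := seq_compact A_compact w2A.
  have w1p' : (fun n => (w (phi (psi n))).1) @ \oo --> p1.
    exact: (cvg_subseq (phi := psi) psiP w1p).
  have Fu : (fun n => F (u (phi (psi n)) *: x)) @ \oo --> F (t *: x).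
    apply: (seq_continuous F_cont (fun n => uA (phi (psi n))) tA); apply: cvgZ'.
    apply: (cvg_subseq (phi := fun n => phi (psi n)) _ ut) => n.
    by rewrite (leq_trans (psiP n)).
  have Fp1 : F p1 = F (t *: x).
    apply: (cvg_unique (@norm_hausdorff _ _) _ Fu).
    rewrite (_ : (fun n => F (u (phi (psi n)) *: x)) = F \o (fun n => (w (phi (psi n))).1)).
      by apply: (seq_continuous F_cont _ Ap1 w1p').
    by apply/funext => n /=; case: (wP (phi (psi n))) => _ _ ->.
  have Fp2 : F p2 = F (t *: x).
    apply: (cvg_unique (@norm_hausdorff _ _) _ Fu).
    rewrite (_ : (fun n => F (u (phi (psi n)) *: x)) = F \o (fun n => (w (phi (psi n))).2)).
      by apply: (seq_continuous F_cont _ Ap2 w2p) => n; exact: w2A.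
    by apply/funext => n /=; case: (wP (phi (psi n))) => _ _ _ ->.
  have p12 := Pt _ _ Ap1 Ap2 Fp1 Fp2; rewrite -{}p12 in w2p.
  have [U [V [ [ [Q oQ UE] Ux] _ [ [_ Fi _] _ _]]]] := F_loc Ap1.
  have nO : nbhs p1 Q by apply: open_nbhs_nbhs; split=> //; move: Ux; rewrite UE; case.
  have [N1 _ Q1] := w1p' _ nO; have [N2 _ Q2] := w2p _ nO.
  have {}Q1 := Q1 (N1 + N2)%N (leq_addr _ _); have {}Q2 := Q2 (N1 + N2)%N (leq_addl _ _).
  have [a1 a2 f1 f2] := wP (phi (psi (N1 + N2)%N)); apply.
  by apply: Fi; rewrite ?f1 ?f2//; apply/mem_set; rewrite UE; split.
Qed.

End Injectivity.

Section Kolmogorov.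
Context {R : realType} {d : nat}.
Implicit Types (x y z u : 'rV[R]_d).

Lemma boxP (K : R) x : vitv 0 (K *: ones) x <-> forall i, 0 <= x 0 i <= K.
Proof.
split=> [[x0 _ xK] i|al]; first by have := xK i; rewrite !mxE mulr1 x0 => ->.
split=> i; last by rewrite !mxE mulr1; case/andP: (al i).
  by case/andP: (al i).
by rewrite mxE; case/andP: (al i).
Qed.

Lemma box_compact (K : R) : compact (vitv 0 (K *: ones) : set 'rV[R]_d).
Proof.
have := @rV_compact R d (fun=> `[0, K]%classic) (fun=> @segment_compact _ _ _).
congr compact; apply/seteqP; split=> x /=; rewrite boxP.
  by move=> al i; have := al i; rewrite /= in_itv.
by move=> al i /=; rewrite in_itv; exact: al.
Qed.

Lemma vleP x y : vle x y <-> x = y \/ vlt x y.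
Proof.
split=> [xy|[->//|[]//]]; have [->|ne] := eqVneq x y; first by left.
by right; split=> //; apply/eqP.
Qed.

Variable f : 'rV[R]_d -> 'rV[R]_d.
Local Notation F := (kolmogorov f).
Hypothesis f_cont : {within Cplus, continuous f}.
Hypothesis f_gt0 : forall x, Cplus x -> vll 0 (f x).

Lemma kolmogorovE x i : F x 0 i = x 0 i * f x 0 i.
Proof. by rewrite mxE. Qed.

Lemma f_pos x i : Cplus x -> 0 < f x 0 i.
Proof. by move=> /f_gt0/(_ i); rewrite mxE. Qed.

Lemma kolmogorov_Cplus x : Cplus x -> Cplus (F x).
Proof. by move=> x0 i; rewrite kolmogorovE mulr_ge0// ltW// f_pos. Qed.

Lemma iter_Cplus n x : Cplus x -> Cplus (iter n F x).
Proof. by move=> x0; elim: n => //= n IH; exact: kolmogorov_Cplus. Qed.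

Lemma kolmogorov_eq0 x i : Cplus x -> (F x 0 i = 0) <-> (x 0 i = 0).
Proof.
move=> x0; rewrite kolmogorovE; split=> [/eqP|->]; last by rewrite mul0r.
by rewrite mulf_eq0 (gt_eqF (f_pos _ _))// orbF => /eqP.
Qed.

Lemma kolmogorov_cont : {within Cplus, continuous F}.
Proof.
apply: within_continuous_seq => u p uC pC up; apply/cvg_rowP => i.
have fu : (fun n => f (u n)) @ \oo --> f p := seq_continuous f_cont uC pC up.
rewrite kolmogorovE; under [X in X @ _ --> _]funext => n do rewrite kolmogorovE.
by apply: cvgM; [move/cvg_rowP : up|move/cvg_rowP : fu].
Qed.

Lemma cvg_Cplus (u : nat -> 'rV[R]_d) p : (forall n, Cplus (u n)) -> u @ \oo --> p -> Cplus p.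
Proof.
move=> uC /cvg_rowP up i; apply: (cvgr_to_ge (up i)).
by exists 0%N => // n _; exact: uC.
Qed.

Lemma kolmogorov_seq (u : nat -> 'rV[R]_d) p : (forall n, Cplus (u n)) ->
  u @ \oo --> p -> (fun n => F (u n)) @ \oo --> F p.
Proof. by move=> uC up; exact: (seq_continuous kolmogorov_cont uC (cvg_Cplus uC up) up). Qed.

(* A Poincare-Miranda argument: the labelling asks whether the i-th coordinate
   of F is at least z_i, and outside [0, a'] it is overruled so as to satisfy
   the boundary conditions.  The hypothesis keeps the limit point away from the
   region where the label was overruled. *)
Lemma kolmogorov_surj (K : R) z a : Cplus z -> Cplus a -> vll a (K *: ones) -> 0 < K ->
  (forall u, vitv 0 (K *: ones) u -> vle (F u) z -> vle u a) ->
  exists2 u, vitv 0 a u & F u = z.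
Proof.
move=> z0 a0 aK K0 Fa.
have aK' i : a 0 i < K by have := aK i; rewrite !mxE mulr1.
(* The midpoint leaves slack on both sides: corners with a coordinate [K] are overruled, points near
   some [p <= a] are not. *)
pose a' i := (a 0 i + K) / 2.
have aa' i : a 0 i < a' i by have := aK' i; rewrite /a'; lra.
have a'K i : a' i < K by have := aK' i; rewrite /a'; lra.
pose pt n (q : {ffun 'I_d -> nat}) : 'rV[R]_d := \row_i (K * (q i)%:R / n.+1%:R).
pose l n (q : {ffun 'I_d -> nat}) i := (q i != 0)%N &&
  ((z 0 i <= F (pt n q) 0 i) || ~~ [forall j, pt n q 0 j <= a' j]).
have l0 n (q : {ffun 'I_d -> nat}) i : q i = 0%N -> l n q i = false by rewrite /l => ->.
have ln n (q : {ffun 'I_d -> nat}) i : q i = n.+1 -> l n q i.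
  move=> qi; rewrite /l qi /=; apply/orP; right; rewrite negb_forall; apply/existsP; exists i.
  by rewrite mxE qi mulfK ?pnatr_eq0// -ltNge.
have ex n : exists q : {ffun 'I_d -> nat} * ('I_d -> {set 'I_d} * {set 'I_d}),
    (forall i, (q.1 i < n.+1)%N) /\
    forall i, l n (shift q.1 (q.2 i).1) i /\ ~~ l n (shift q.1 (q.2 i).2) i.
  have [q qn qP] := kuhn_cube (ltn0Sn n) (l0 n) (ln n).
  have ex2 i : exists J : {set 'I_d} * {set 'I_d}, l n (shift q J.1) i /\ ~~ l n (shift q J.2) i.
    by have [[J1 l1] [J2 l2]] := qP i; exists (J1, J2).
  by have [J JP] := choice ex2; exists (q, J).
have [q qP] := choice ex.
have ptE n (r : {ffun 'I_d -> nat}) i : pt n r 0 i = K * (r i)%:R / n.+1%:R by rewrite mxE.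
have pt_ge0 n r : Cplus (pt n r).
  by move=> i; rewrite ptE !mulr_ge0 ?invr_ge0 ?ler0n// ltW.
have ptbox n : vitv 0 (K *: ones) (pt n (q n).1).
  apply/boxP => i; rewrite pt_ge0/= ptE -mulrA ger_pMr// ler_pdivrMr ?ltr0n// mul1r ler_nat ltnW//.
  by case: (qP n).
have [p [phi [pbox phiP up]]] := seq_compact (@box_compact K) ptbox.
have p0 : Cplus p by case: pbox.
have near_p (J : nat -> {set 'I_d}) :
    (fun n => pt (phi n) (shift (q (phi n)).1 (J n))) @ \oo --> p.
  apply/cvg_rowP => i; move/cvg_rowP/(_ i) : up => up.
  have e0 : (fun n => K * ((i \in J n)%:R / (phi n).+1%:R)) @ \oo --> (0 : R).
    apply/cvgrPdist_le => e e0; have eK : 0 < e / K by rewrite divr_gt0.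
    have [N _ NP] := near_infty_natSinv_lt (PosNum eK).
    exists N => // n /= Nn; rewrite sub0r normrN ger0_norm; last first.
      by rewrite !mulr_ge0 ?invr_ge0 ?ler0n// ltW.
    rewrite mulrC -ler_pdivlMr//; apply: le_trans (ltW (NP _ (leq_trans Nn (phiP n)))).
    rewrite ler_pdivrMr ?ltr0n// mulVf ?pnatr_eq0//.
    by case: (_ \in _).
  rewrite -[p 0 i]addr0; apply: cvg_trans (cvgD up e0); apply: near_eq_cvg; near=> n.
  by rewrite /= !ptE ffunE natrD mulrDr mulrDl fctE /= ptE mulrA.
have F_near (J : nat -> {set 'I_d}) i :
    (fun n => F (pt (phi n) (shift (q (phi n)).1 (J n))) 0 i) @ \oo --> F p 0 i.
  have /cvg_rowP := kolmogorov_seq (fun n => pt_ge0 _ _) (near_p J); exact.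
(* If [p j] exceeded [a' j], label [j] would be overruled to true at all corners near [p], including
   the one where it is false. *)
have pa' j : p 0 j <= a' j.
  rewrite leNgt; apply/negP => lt.
  have /cvg_rowP/(_ j)/cvgr_gt/(_ _ lt) := near_p (fun n => ((q (phi n)).2 j).2).
  case=> N _ /(_ N (leqnn N)) /=; set w := pt _ _ => wj.
  have [_ /(_ j)[_]] := qP (phi N); rewrite /l -/w.
  have -> /= : (shift (q (phi N)).1 ((q (phi N)).2 j).2 j != 0)%N.
    apply: contraTneq wj => e; rewrite -leNgt ptE e mulr0 mul0r.
    by have := a0 j; have := aa' j; lra.
  by rewrite negb_or negbK => /andP[_ /forallP/(_ j)]; rewrite leNgt wj.
(* Uses the corners where label [i] is false; if that is due to [q i = 0], the [i]-th coordinate of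
   [F] vanishes there. *)
have Fpz : vle (F p) z.
  move=> i; apply: (cvgr_to_le (F_near (fun n => ((q (phi n)).2 i).2) i)).
  exists 0%N => // n _ /=; have [_ /(_ i)[_]] := qP (phi n); rewrite /l negb_and negbK.
  case/orP=> [/eqP e|]; first by rewrite kolmogorovE ptE e mulr0 !mul0r.
  by rewrite negb_or -ltNge => /andP[/ltW].
have pa := Fa p pbox Fpz.
exists p; first by split=> // i; rewrite mxE.
apply/rowP => i; apply/eqP; rewrite eq_le Fpz/=.
(* As [p <= a] lies strictly below [a'], nearby corners are not overruled, and a true label now
   bounds [F] from below. *)
pose J n := ((q (phi n)).2 i).1.
have wa : \forall n \near \oo, forall j, pt (phi n) (shift (q (phi n)).1 (J n)) 0 j < a' j.
  apply: filter_forall => j; have /cvg_rowP/(_ j)/cvgr_lt := near_p J; apply.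
  exact: le_lt_trans (pa j) (aa' j).
apply: (cvgr_to_ge (F_near J i)).
apply: filterS wa => n al; have [_ /(_ i)[+ _]] := qP (phi n); rewrite /l => /andP[_ /orP[//|]].
by rewrite negb_forall => /existsP[j]; rewrite -ltNge ltNge ltW// al.
Unshelve. all: by end_near. Qed.

End Kolmogorov.

(** * Attractor and carrying simplex of an inverse-monotone Kolmogorov map *)

Section RealSequences.
Context {R : realType}.

(** The sequence converges: a limit below [c] gives the first alternative, and near a positive limit
    consecutive quotients are below [rho]. It serves to exclude a uniform decrease by [rho] at late
    times. *)
Lemma nonincreasing_ratio (r : nat -> R) (c rho : R) : (forall n, 0 <= r n) ->
  (forall n, r n.+1 <= r n) -> 0 < c -> 1 < rho ->
  exists N, forall n, (N <= n)%N -> r n < c \/ r n < rho * r n.+1.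
Proof.
move=> r0 rS c0 rho1.
have ni : nonincreasing_seq r by apply/nonincreasing_seqP.
have lb : has_lbound (range r) by exists 0 => _ [n _ <-].
have rl := nonincreasing_cvgn ni lb; set l := inf _ in rl.
have lr n : l <= r n by apply: ge_inf => //; exists n.
have [lc|cl] := ltP l c.
  move/cvgrPdist_lt : rl => /(_ (c - l)); rewrite subr_gt0 => /(_ lc) [N _ NP].
  exists N => n /NP /=; rewrite distrC ger0_norm ?subr_ge0// => ?; left; lra.
have l0 : 0 < (rho - 1) * l by rewrite mulr_gt0 ?subr_gt0// (lt_le_trans c0).
move/cvgrPdist_lt : rl => /(_ _ l0) [N _ NP].
exists N => n /NP /=; rewrite distrC ger0_norm ?subr_ge0// => rn; right.
have : rho * l <= rho * r n.+1 by rewrite ler_wpM2l// ltW// (lt_trans ltr01).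
lra.
Qed.

End RealSequences.

Section Attractors.
Context {R : realType} {d : nat}.
Implicit Types (x y : 'rV[R]_d) (A B : set 'rV[R]_d).

Lemma enorm_lt x (e : R) : 0 < e -> (forall i, `|x 0 i| < e / d.+1%:R) -> enorm x < e.
Proof.
move=> e0 xe; apply: le_lt_trans (enorm_le (fun i => ltW (xe i))) _.
by rewrite mulrCA gtr_pMr// ltr_pdivrMr ?ltr0n// mul1r ltr_nat.
Qed.

Lemma bounded_setP A : bounded_set A <-> exists M : R, forall x, A x -> forall i, `|x 0 i| <= M.
Proof.
split=> [[M [_ MA]]|[M MA]].
  exists (M + 1) => x Ax i; apply: le_trans (normr_coord_le x i) _.
  by apply: (MA (M + 1)) => //; rewrite ltrDl.
exists `|M|; split; [exact: num_real|move=> r Mr x Ax].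
apply: normr_le_coord => [|i]; first by rewrite (le_trans _ (ltW Mr)).
by apply: le_trans (MA x Ax i) _; rewrite (le_trans (ler_norm _))// ltW.
Qed.

Lemma bounded_subset A B : A `<=` B -> bounded_set B -> bounded_set A.
Proof.
by move=> AB /bounded_setP[M BM]; apply/bounded_setP; exists M => x /AB; exact: BM.
Qed.

Lemma asymptoticP (F : 'rV[R]_d -> 'rV[R]_d) x y :
  (forall c : R, 0 < c -> exists N, forall n, (N <= n)%N ->
    forall i, `|iter n F x 0 i - iter n F y 0 i| < c) -> asymptotic F x y.
Proof.
move=> h; apply/cvgrPdist_lt => e e0.
have [|N NP] := h (e / d.+1%:R); first by rewrite divr_gt0.
exists N => // n /NP /= al; rewrite sub0r normrN ger0_norm ?enorm_ge0//.
by apply: enorm_lt => // i; rewrite !mxE.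
Qed.

(** A point of an invariant set is an [n]-th image of a point of that set for every [n], hence
    arbitrarily close to the other attractor, which is closed. *)
Lemma compact_attractor_unique (F : 'rV[R]_d -> 'rV[R]_d) A B :
  compact_attractor F A -> compact_attractor F B -> A = B.
Proof.
have sub A' B' : compact_attractor F A' -> compact_attractor F B' -> A' `<=` B'.
  move=> [A0 cA AC FA _] [B0 cB _ _ Batt] x Ax.
  have iterA n z : A' z -> exists2 w, A' w & iter n F w = z.
    elim: n z => [|n IH] z Az; first by exists z.
    move: Az; rewrite -{1}FA => -[w Aw <-]; have [v Av <-] := IH w Aw.
    by exists v.
  have ex (n : nat) : exists y, B' y /\ enorm (x - y) < n.+1%:R^-1.
    have n0 : 0 < n.+1%:R^-1 :> R by rewrite invr_gt0 ltr0n.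
    have [N NP] := Batt A' AC (compact_bounded cA) _ n0.
    have [w Aw wx] := iterA N x Ax.
    have := NP N w (leqnn N) Aw; rewrite wx => /(edistance_ltP B0)[y By xy].
    by exists y.
  have [u uP] := choice ex.
  apply: (cvg_in_compact (u := u) cB); first by move=> n; case: (uP n).
  apply/cvg_rowP => i; apply/cvgrPdist_lt => e e0.
  have [N _ NP] := near_infty_natSinv_lt (PosNum e0).
  exists N => // n /NP /= lt; apply: le_lt_trans (lt_trans (uP n).2 lt).
  by apply: le_trans (normr_coord_le_enorm _ i); rewrite !mxE.
by move=> hA hB; apply/seteqP; split; exact: sub.
Qed.

Lemma l1norm_cvg (u : nat -> 'rV[R]_d) x : u @ \oo --> x ->
  (fun n => l1norm (u n)) @ \oo --> l1norm x.
Proof.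
move=> /cvg_rowP ux; rewrite /l1norm; apply: cvg_big => [|i _]; first exact: add_continuous.
exact: cvg_norm (ux i).
Qed.

Lemma l1norm_gt0 x : x <> 0 -> 0 < l1norm x.
Proof.
move=> x0; rewrite lt_neqAle eq_sym sumr_ge0// andbT; apply/eqP => e; apply: x0.
apply/rowP => i; rewrite mxE; apply/normr0_eq0/eqP.
by move/eqP : e; rewrite psumr_eq0// => /allP/(_ i); rewrite mem_index_enum => /(_ isT).
Qed.

Lemma l1normZ x (a : R) : 0 <= a -> l1norm (a *: x) = a * l1norm x.
Proof.
move=> a0; rewrite /l1norm mulr_sumr; apply: eq_bigr => i _.
by rewrite mxE normrM ger0_norm.
Qed.

(* Two points of A cannot differ by a vector with all coordinates of the same
   strict sign, which bounds the mean of the difference by its projection. *)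
Lemma orth_proj_lipschitz A : (forall x y, A x -> A y -> ~ vll x y) -> (0 < d)%N ->
  orth_proj_inv_lipschitz A.
Proof.
move=> nll d0; have dpos : 0 < d%:R :> R by rewrite ltr0n.
have key x y : A x -> A y -> enorm (x - y) <= d%:R * 2 * enorm (orth_proj x - orth_proj y).
  move=> Ax Ay; set w := x - y.
  have we : orth_proj x - orth_proj y = w - (dotv w ones / d%:R) *: ones.
    rewrite /orth_proj (_ : dotv w ones = dotv x ones - dotv y ones).
      by rewrite mulrBl scalerBl !opprB addrACA [RHS]addrACA [in RHS](addrC (- y)).
    by rewrite /dotv -sumrB; apply: eq_bigr => i _; rewrite !mxE mulrBl.
  rewrite we; set m := _ / _; set E := enorm (w - m *: ones).
  have wE i : `|w 0 i - m| <= E.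
    by apply: le_trans (normr_coord_le_enorm _ i); rewrite !mxE mulr1.
  (* A nonnegative and a nonpositive coordinate of [w], each within [E] of the mean [m], pin [m] to
     [[-E, E]]. Every coordinate is then at most [2 E] in absolute value. *)
  have [i xi] : exists i, 0 <= w 0 i.
    apply: contrapT => no; apply: (nll x y) => // i; rewrite ltNge; apply/negP => yx.
    by apply: no; exists i; rewrite !mxE subr_ge0.
  have [j xj] : exists j, w 0 j <= 0.
    apply: contrapT => no; apply: (nll y x) => // j; rewrite ltNge; apply/negP => yx.
    by apply: no; exists j; rewrite !mxE subr_le0.
  have mE : `|m| <= E.
    have := wE i; have := wE j; rewrite !ler_norml => /andP[h1 h2] /andP[h3 h4].
    by apply/andP; split; lra.
  rewrite -mulrA; apply: enorm_le => k; rewrite mulr2n mulrDl !mul1r.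
  by rewrite -[w 0 k](subrK m) (le_trans (ler_normD _ _))// lerD.
pose g p := xget 0 [set x | A x /\ orth_proj x = p].
have gP x : A x -> A (g (orth_proj x)) /\ orth_proj (g (orth_proj x)) = orth_proj x.
  by move=> Ax; apply: (@xgetPex _ 0 [set z | A z /\ orth_proj z = orth_proj x]); exists x.
have gK x : A x -> g (orth_proj x) = x.
  move=> Ax; have [Ag eg] := gP x Ax; have := key _ _ Ag Ax.
  rewrite eg subrr (_ : enorm 0 = 0); last first.
    by apply/eqP; rewrite eq_le enorm_ge0 andbT (le_trans (enorm_le_sum _))// big1// => i _; rewrite mxE normr0.
  rewrite mulr0 => le; apply/rowP => i; apply/eqP; rewrite -subr_eq0 -normr_le0.
  by apply: le_trans le; apply: le_trans (normr_coord_le_enorm _ i); rewrite !mxE.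
exists g; split=> //; exists (d%:R * 2) => _ _ [x Ax <-] [y Ay <-].
by rewrite !gK//; exact: key.
Qed.

End Attractors.

Lemma ratio_kolmogorov (R : fieldType) (x y fx fy : R) : fy != 0 ->
  x * fx / (y * fy) * fy = x / y * fx.
Proof. by move=> fy0; rewrite invfM -!mulrA mulVf// mulr1 (mulrC fx). Qed.

Lemma ratio_le (R : realFieldType) (r r' fx fy : R) : fy <= fx -> 0 < fy -> 0 <= r' ->
  r * fy = r' * fx -> r' <= r.
Proof. by move=> fyx fy0 r'0 e; rewrite -(ler_pM2r fy0) e ler_wpM2l. Qed.

Section Core.
Context {R : realType} {d : nat}.
Implicit Types (x y z u v : 'rV[R]_d) (M : set 'rV[R]_d).
Variable f : 'rV[R]_d -> 'rV[R]_d.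
Local Notation F := (kolmogorov f).
Hypothesis f_cont : {within Cplus, continuous f}.
Hypothesis f_gt0 : forall x, Cplus x -> vll 0 (f x).
Variables K b : R.
Hypothesis b_gt0 : 0 < b.
Hypothesis bK : b < K.
Let box : set 'rV[R]_d := vitv 0 (K *: ones).
Let L : set 'rV[R]_d := vitv 0 (b *: ones).
Hypothesis F_inj : forall x y, box x -> box y -> F x = F y -> x = y.
Hypothesis F_iso : forall x y, box x -> box y -> vle (F x) (F y) -> vle x y.
Hypothesis F_isoS : forall x y i, box x -> box y -> vle (F x) (F y) ->
  F x 0 i < F y 0 i -> x 0 i < y 0 i.
Hypothesis f_anti : forall x y i, box x -> box y -> vle (F x) (F y) ->
  f y 0 i <= f x 0 i.
Hypothesis f_antiS : forall x y i, box x -> box y -> vle (F x) (F y) ->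
  0 < x 0 i -> x 0 i < y 0 i -> f y 0 i < f x 0 i.
Hypothesis F_L : forall x, L x -> L (F x).
Hypothesis f0_gt1 : forall i, 1 < f 0 0 i.

Lemma L_box x : L x -> box x.
Proof.
move=> /boxP xL; apply/boxP => i; have /andP[-> xb] := xL i.
exact: le_trans xb (ltW bK).
Qed.

Lemma L_Cplus x : L x -> Cplus x. Proof. by case. Qed.

Lemma L_down x z : L x -> Cplus z -> vle z x -> L z.
Proof.
move=> /boxP xL z0 zx; apply/boxP => i; rewrite z0 /=.
by apply: le_trans (zx i) _; case/andP: (xL i).
Qed.

Lemma vle_trans y x z : vle x y -> vle y z -> vle x z.
Proof. by move=> xy yz i; exact: le_trans (xy i) (yz i). Qed.

Lemma vle_anti x y : vle x y -> vle y x -> x = y.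
Proof. by move=> xy yx; apply/rowP => i; apply/eqP; rewrite eq_le xy yx. Qed.

Lemma iter_L n x : L x -> L (iter n F x).
Proof. by move=> xL; elim: n => //= n IH; exact: F_L. Qed.

Lemma iter_iso n x y : L x -> L y -> vle (iter n F x) (iter n F y) -> vle x y.
Proof.
move=> xL yL; elim: n => // n IH /= le; apply: IH.
by apply: F_iso => //; apply/L_box/iter_L.
Qed.

Lemma iter_inj n x y : L x -> L y -> iter n F x = iter n F y -> x = y.
Proof. by move=> xL yL e; apply: vle_anti; apply: (@iter_iso n) => // i; rewrite e. Qed.

Lemma iter_seq n (u : nat -> 'rV[R]_d) p : (forall n, Cplus (u n)) -> u @ \oo --> p ->
  (fun m => iter n F (u m)) @ \oo --> iter n F p.
Proof.
move=> uC up; elim: n => //= n IH; apply: kolmogorov_seq => // m.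
exact: (iter_Cplus f_gt0).
Qed.

(** Inverse monotonicity is the a priori bound that [kolmogorov_surj] asks for, and [b < K] is the
    room it needs. *)
Lemma F_down x z : L x -> Cplus z -> vle z (F x) -> exists2 u, vitv 0 x u & F u = z.
Proof.
move=> xL z0 zx; apply: (kolmogorov_surj f_cont (K := K)) => //.
- exact: L_Cplus.
- move=> i; rewrite !mxE mulr1; apply: le_lt_trans bK.
  by move/boxP : xL => /(_ i)/andP[].
- exact: lt_trans bK.
- move=> u ubox uz; apply: F_iso => //; first exact: L_box.
  exact: vle_trans zx.
Qed.

Lemma iter_down n x z : L x -> Cplus z -> vle z (iter n F x) ->
  exists2 u, L u & iter n F u = z.
Proof.
elim: n z => [z xL z0 zx|n IH z xL z0 /= zx]; first by exists z => //; apply: L_down zx.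
have [w [w0 _ wx] <-] := F_down (iter_L n xL) z0 zx.
by have [u uL <-] := IH w xL w0 wx; exists u.
Qed.

Definition bump (e : R) x : 'rV[R]_d := \row_i (x 0 i + e).

(** By compactness, [F u <= F x + eta] still forces [u <= x + e] for small [eta]; this bound again
    yields a preimage. *)
Lemma F_up x (e : R) : Cplus x -> 0 < e -> L (bump e x) ->
  exists2 eta : R, 0 < eta & exists2 u, vitv 0 (bump e x) u & F u = bump eta (F x).
Proof.
move=> x0 e0 xeL.
have xL : L x by apply: L_down xeL _ _ => // i; rewrite mxE lerDl ltW.
suff [eta eta0 etaP] : exists2 eta : R, 0 < eta &
    forall u, box u -> vle (F u) (bump eta (F x)) -> vle u (bump e x).
  exists eta => //; apply: (kolmogorov_surj f_cont (K := K)) => //.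
  - by move=> i; rewrite mxE addr_ge0 ?(ltW eta0)//; exact: (kolmogorov_Cplus f_gt0).
  - exact: L_Cplus.
  - move=> i; rewrite !mxE mulr1; apply: le_lt_trans bK.
    by move/boxP : xeL => /(_ i)/andP[_]; rewrite mxE.
  - exact: lt_trans bK.
apply: contrapT => no.
have ex (n : nat) : exists u, [/\ box u, vle (F u) (bump n.+1%:R^-1 (F x)) & ~ vle u (bump e x)].
  apply: contrapT => nu; apply: no; exists n.+1%:R^-1; first by rewrite invr_gt0 ltr0n.
  by move=> u ubox uF; apply: contrapT => ?; apply: nu; exists u.
have [u uP] := choice ex.
have ubox n : box (u n) by case: (uP n).
have [p [phi [pbox phiP up]]] := seq_compact (@box_compact R d K) ubox.
have uC n : Cplus (u (phi n)) by case: (ubox (phi n)).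
have Fpx : vle (F p) (F x).
  move=> i; have /cvg_rowP/(_ i) Fup := kolmogorov_seq f_cont uC up.
  apply/ler_addgt0Pr => g g0; apply: (cvgr_to_le Fup).
  have [N _ NP] := near_infty_natSinv_lt (PosNum g0).
  exists N => // n /= Nn; have [_ /(_ i) le _] := uP (phi n).
  apply: le_trans le _; rewrite mxE lerD2l ltW//.
  by apply: NP; rewrite /= (leq_trans Nn).
have px := F_iso pbox (L_box xL) Fpx.
have : \forall n \near \oo, forall i, u (phi n) 0 i < x 0 i + e.
  apply: filter_forall => i; move/cvg_rowP/(_ i) : up => /cvgr_lt; apply.
  by apply: le_lt_trans (px i) _; rewrite ltrDl.
case=> N _ /(_ N (leqnn N)) /= al; have [_ _ []] := uP (phi N).
by move=> i; rewrite mxE ltW.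
Qed.

(** * Intersections of the forward images of a set *)

Definition inv_part M : set 'rV[R]_d := [set x | forall n, exists2 y, M y & iter n F y = x].

Lemma inv_part_sub M : inv_part M `<=` M.
Proof. by move=> x /(_ 0%N)[y My <-]. Qed.

Lemma inv_partS M M' : M `<=` M' -> inv_part M `<=` inv_part M'.
Proof. by move=> MM x xM n; have [y /MM ? <-] := xM n; exists y. Qed.

Section Invariant.
Variable M : set 'rV[R]_d.
Hypothesis M_compact : compact M.
Hypothesis ML : M `<=` L.
Hypothesis FM : forall x, M x -> M (F x).

Lemma iter_M n x : M x -> M (iter n F x).
Proof. by move=> Mx; elim: n => //= n; exact: FM. Qed.

(** A [k]-th preimage of the limit is a cluster point of the orbit pieces stopped [k] steps
    earlier. *)
Lemma omega_inv_part (x : nat -> 'rV[R]_d) (m : nat -> nat) p : (forall n, M (x n)) ->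
  (forall n, (n <= m n)%N) -> (fun n => iter (m n) F (x n)) @ \oo --> p -> inv_part M p.
Proof.
move=> xM mP xp k.
(* The truncated subtraction is harmless, since only indices [n >= k] matter for the limit. *)
pose y n := iter (m n - k) F (x n).
have yM n : M (y n) by exact: iter_M.
have [q [phi [Mq phiP yq]]] := seq_compact M_compact yM.
exists q => //.
have h1 := iter_seq (n := k) (fun n => L_Cplus (ML (yM (phi n)))) yq.
have h2 := cvg_subseq phiP xp.
apply: (cvg_unique (@norm_hausdorff _ _) h1).
apply: cvg_trans h2; apply: near_eq_cvg; exists k => // n /= kn.
by rewrite /y /= -iterD subnKC// (leq_trans kn)// (leq_trans (phiP n)).
Qed.

Lemma inv_part_attracts (e : R) : 0 < e -> exists N, forall n x, (N <= n)%N -> M x ->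
  exists2 s, inv_part M s & forall i, `|iter n F x 0 i - s 0 i| < e.
Proof.
move=> e0; apply: contrapT => no.
have ex N : exists w : nat * 'rV[R]_d, [/\ (N <= w.1)%N, M w.2 &
    ~ exists2 s, inv_part M s & forall i, `|iter w.1 F w.2 0 i - s 0 i| < e].
  apply: contrapT => nw; apply: no; exists N => n x Nn Mx.
  by apply: contrapT => ns; apply: nw; exists (n, x).
have [w wP] := choice ex.
have yM n : M (iter (w n).1 F (w n).2) by apply: iter_M; case: (wP n).
have [p [phi [Mp phiP yp]]] := seq_compact M_compact yM.
have pinv : inv_part M p.
  apply: (@omega_inv_part (fun n => (w (phi n)).2) (fun n => (w (phi n)).1)) => // n.
    by case: (wP (phi n)).
  by apply: leq_trans (phiP n) _; case: (wP (phi n)).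
have : \forall n \near \oo, forall i, `|iter (w (phi n)).1 F (w (phi n)).2 0 i - p 0 i| < e.
  apply: filter_forall => i; move/cvg_rowP/(_ i)/cvgrPdist_lt/(_ e e0) : yp.
  by apply: filterS => n /=; rewrite distrC.
case=> N _ /(_ N (leqnn N)) /= al.
by have [_ _] := wP (phi N); apply; exists p.
Qed.

Lemma inv_part_compact : compact (inv_part M).
Proof.
apply: (subclosed_compact _ M_compact (@inv_part_sub M)).
apply: seq_closed => u p uI up n.
have ex k : exists y, M y /\ iter n F y = u k by have [y My <-] := uI k n; exists y.
have [y yP] := choice ex.
have yM k : M (y k) by case: (yP k).
have [q [phi [Mq phiP yq]]] := seq_compact M_compact yM.
exists q => //; have h1 := iter_seq (n := n) (fun k => L_Cplus (ML (yM (phi k)))) yq.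
apply: (cvg_unique (@norm_hausdorff _ _) h1).
rewrite (_ : (fun m => _) = u \o phi); first exact: cvg_subseq up.
by apply/funext => k /=; case: (yP (phi k)).
Qed.

Lemma inv_part_F x : inv_part M x -> inv_part M (F x).
Proof. by move=> xI n; have [y My <-] := xI n; exists (F y); [exact: FM|rewrite -iterSr]. Qed.

(** Injectivity makes the preimage independent of the depth [n], so a single point lies in all the
    images. *)
Lemma inv_part_preimage x : inv_part M x -> exists2 y, inv_part M y & F y = x.
Proof.
move=> xI; have [z Mz zx] := xI 1%N; exists z => // n.
have [y My yx] := xI n.+1; exists y => //; apply: F_inj.
- by apply/L_box/ML/iter_M.
- exact/L_box/ML.
- by rewrite -iterS yx.
Qed.

Lemma inv_part_image : F @` inv_part M = inv_part M.
Proof.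
apply/seteqP; split=> [_ [x xI <-]|x /inv_part_preimage[y yI <-]]; last by exists y.
exact: inv_part_F.
Qed.

End Invariant.

(** The inverse branch of [F] with values in [L]; the default 0 does not arise on an invariant part
    of [L]. *)
Definition G y := xget 0 [set x | L x /\ F x = y].

Lemma GK x : L x -> G (F x) = x.
Proof.
move=> xL; have [GL GF] := @xgetPex _ 0 [set z | L z /\ F z = F x]
  (ex_intro _ x (conj xL erefl)).
by apply: F_inj => //; exact: L_box.
Qed.

Lemma inv_part_G M x : M `<=` L -> (forall x, M x -> M (F x)) -> inv_part M x ->
  inv_part M (G x) /\ F (G x) = x.
Proof.
by move=> ML FM /(inv_part_preimage ML FM)[y yI <-]; rewrite GK//; exact: ML (inv_part_sub yI).
Qed.

Lemma inv_part_iterG M x n : M `<=` L -> (forall x, M x -> M (F x)) -> inv_part M x ->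
  inv_part M (iter n G x) /\ iter n F (iter n G x) = x.
Proof.
move=> ML FM; elim: n x => //= n IH x xI; have [I1 e1] := IH x xI.
have [I2 e2] := inv_part_G ML FM I1; split => //.
by rewrite -iterS iterSr e2.
Qed.

Lemma iter_GK n x : L x -> iter n G (iter n F x) = x.
Proof.
by move=> xL; elim: n => // n IH; rewrite iterSr [iter n.+1 F x]iterS GK//; exact: iter_L.
Qed.

(** * The attractor Gamma *)

Definition Gam := inv_part L.

Lemma L_compact : compact L. Proof. exact: box_compact. Qed.
Lemma Gam_L x : Gam x -> L x. Proof. exact: inv_part_sub. Qed.
Lemma Gam_Cplus x : Gam x -> Cplus x. Proof. by move/Gam_L/L_Cplus. Qed.
Lemma Gam_compact : compact Gam. Proof. exact: inv_part_compact L_compact _. Qed.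
Lemma Gam_F x : Gam x -> Gam (F x). Proof. exact: inv_part_F. Qed.
Lemma Gam_G x : Gam x -> Gam (G x). Proof. by move=> /(inv_part_G (fun=> id) F_L)[]. Qed.
Lemma Gam_FG x : Gam x -> F (G x) = x. Proof. by move=> /(inv_part_G (fun=> id) F_L)[]. Qed.
Lemma Gam_iterG n x : Gam x -> Gam (iter n G x).
Proof. by move=> /(inv_part_iterG n (fun=> id) F_L)[]. Qed.
Lemma Gam_iterFG n x : Gam x -> iter n F (iter n G x) = x.
Proof. by move=> /(inv_part_iterG n (fun=> id) F_L)[]. Qed.

Lemma Gam_down x z : Gam x -> Cplus z -> vle z x -> Gam z.
Proof.
move=> xG z0 zx n; have [y yL yx] := xG n.
by rewrite -yx in zx; exact: iter_down yL z0 zx.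
Qed.

Lemma G_eq0 x i : Gam x -> (G x 0 i = 0) <-> (x 0 i = 0).
Proof.
move=> xG; rewrite -[in X in _ <-> X](Gam_FG xG).
by rewrite kolmogorov_eq0//; exact/Gam_Cplus/Gam_G.
Qed.

Lemma iterG_eq0 n x i : Gam x -> (iter n G x 0 i = 0) <-> (x 0 i = 0).
Proof. by move=> xG; elim: n => //= n IH; rewrite G_eq0//; exact: Gam_iterG. Qed.

Lemma iterG_le n x y : Gam x -> Gam y -> vle x y -> vle (iter n G x) (iter n G y).
Proof.
move=> xG yG xy; apply: (@iter_iso n); rewrite ?Gam_iterFG//; exact/Gam_L/Gam_iterG.
Qed.

(** Transfers room above a point near the origin to all its forward images. *)
Lemma Gam_up x (e : R) n : Gam x -> 0 < e -> Gam (bump e x) ->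
  exists2 eta : R, 0 < eta & Gam (bump eta (iter n F x)).
Proof.
move=> xG e0 xeG; elim: n => [|n [eta eta0 IH]]; first by exists e.
have xnG : Gam (iter n F x) by elim: (n) => //= k; exact: Gam_F.
have [eta' eta'0 [u [u0 _ ux] uE]] := F_up (Gam_Cplus xnG) eta0 (Gam_L IH).
by exists eta' => //=; rewrite -uE; apply: Gam_F; exact: Gam_down ux.
Qed.

(** * The repelling box at the origin and the set Sigma *)

Definition small (del : R) := [/\ 0 < del, del <= b &
  forall x, Cplus x -> (forall i, x 0 i <= del) -> forall i, 1 < f x 0 i].

Lemma ex_small : exists del : R, small del.
Proof.
apply: contrapT => no.
have ex (n : nat) : exists x, [/\ Cplus x, forall i, x 0 i <= n.+1%:R^-1 & ~ forall i, 1 < f x 0 i].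
  apply: contrapT => nx; apply: no; exists (Num.min b n.+1%:R^-1); split.
  - by rewrite lt_min b_gt0 invr_gt0 ltr0n.
  - by rewrite ge_min lexx.
  move=> x x0 xd i; apply: contrapT => ni; apply: nx; exists x; split=> // j.
  by have := xd j; rewrite le_min => /andP[].
have [u uP] := choice ex.
have uC n : Cplus (u n) by case: (uP n).
have u0 : u @ \oo --> (0 : 'rV[R]_d).
  apply/cvg_rowP => i; rewrite mxE; apply/cvgrPdist_lt => e e0.
  have [N _ NP] := near_infty_natSinv_lt (PosNum e0).
  exists N => // n /NP /= lt; rewrite sub0r normrN ger0_norm; last exact: uC.
  by apply: le_lt_trans lt; case: (uP n).
have C0 : Cplus (0 : 'rV[R]_d) by move=> i; rewrite mxE.
have fu : (fun n => f (u n)) @ \oo --> f 0 := seq_continuous f_cont uC C0 u0.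
have : \forall n \near \oo, forall i, 1 < f (u n) 0 i.
  by apply: filter_forall => i; move/cvg_rowP/(_ i)/cvgr_gt : fu; apply; exact: f0_gt1.
by case=> N _ /(_ N (leqnn N)) /= al; have [_ _] := uP N; apply.
Qed.

Lemma smallS (del del' : R) : small del -> 0 < del' -> del' <= del -> small del'.
Proof.
move=> [d0 db sd] d'0 d'd; split=> //; first exact: le_trans db.
by move=> x x0 xd; apply: sd => // i; exact: le_trans (xd i) d'd.
Qed.

Definition core (del : R) : set 'rV[R]_d := [set x | Cplus x /\ forall i, x 0 i < del].

Lemma core_L del x : small del -> core del x -> L x.
Proof.
move=> [_ db _] [x0 xd]; apply/boxP => i; rewrite x0 /=.
by apply: le_trans db; exact: ltW.
Qed.

(** As [f > 1] on the box, [F] sends its top corner strictly above itself, so points of [core] have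
    preimages below that corner, strictly by [F_isoS]. Hence [core] lies in its own image, and its
    complement in [L] is forward invariant. *)
Lemma core_preimage del x : small del -> core del x -> exists2 u, core del u & F u = x.
Proof.
move=> sd [x0 xd]; have [d0 db dP] := sd.
have dL : L (del *: ones) by apply/boxP => i; rewrite !mxE mulr1 ltW.
have Fd i : del < F (del *: ones) 0 i.
  rewrite kolmogorovE mxE [ones _ _]mxE mulr1 ltr_pMr//; apply: dP => [|j].
    exact: L_Cplus.
  by rewrite !mxE mulr1.
have xF : vle x (F (del *: ones)) by move=> i; apply: ltW (lt_trans (xd i) (Fd i)).
have [u [u0 _ ud] uE] := F_down dL x0 xF.
exists u => //; split=> // i.
suff : u 0 i < (del *: ones : 'rV[R]_d) 0 i by rewrite !mxE mulr1.
apply: F_isoS; rewrite ?uE//; [|exact: L_box|exact: lt_trans (Fd i)].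
by apply/L_box/(L_down dL).
Qed.

Lemma core_Gam del x : small del -> core del x -> Gam x.
Proof.
move=> sd xd n; suff [u uc ux] : exists2 u, core del u & iter n F u = x.
  by exists u => //; exact: core_L uc.
elim: n x xd => [|n IH] x xd; first by exists x.
have [w wd <-] := core_preimage sd xd; have [u ud <-] := IH w wd.
by exists u.
Qed.

Definition shell (del : R) : set 'rV[R]_d := L `\` core del.
(** As the invariant part of a compact forward invariant set, Sigma inherits compactness, invariance
    and attraction from the general facts on [inv_part]; [notSigP] recovers it as the complement of
    the points repelled from 0. *)
Definition Sig (del : R) := inv_part (shell del).

Lemma shell_L del : shell del `<=` L. Proof. by move=> x []. Qed.

Lemma shell_F del : small del -> forall x, shell del x -> shell del (F x).
Proof.
move=> sd x [xL xd]; split; first exact: F_L.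
move=> /(core_preimage sd)[u ud uE]; apply: xd.
by rewrite -(F_inj _ _ uE)//; apply: L_box => //; exact: core_L ud.
Qed.

Lemma shell_compact del : compact (shell del).
Proof.
apply: (subclosed_compact _ L_compact (@shell_L del)).
apply: seq_closed => u p uS up; split.
  by apply: (cvg_in_compact L_compact _ up) => n; case: (uS n).
move=> [p0 pd]; have : \forall n \near \oo, forall i, u n 0 i < del.
  by apply: filter_forall => i; move/cvg_rowP/(_ i)/cvgr_lt : up; apply.
case=> N _ /(_ N (leqnn N)) /= al; have [uL] := uS N; apply; split => //.
exact: L_Cplus.
Qed.

Lemma Sig_Gam del : Sig del `<=` Gam.
Proof. exact: inv_partS (@shell_L del). Qed.

Lemma Sig_compact del : compact (Sig del).
Proof. exact: inv_part_compact (@shell_compact del) (@shell_L del). Qed.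

Lemma notSigP del x : Gam x -> ~ Sig del x <-> exists n, core del (iter n G x).
Proof.
move=> xG; split=> [nS|[n xn] /(_ n)[y [yL yd] yx]].
  apply: contrapT => nn; apply: nS => n; exists (iter n G x); last exact: Gam_iterFG.
  by split; [exact/Gam_L/Gam_iterG|move=> ?; apply: nn; exists n].
by apply: yd; rewrite -(iter_GK n yL) yx.
Qed.

(** * Contraction of coordinate ratios along backward orbits *)

(** Strict monotonicity made uniform by compactness: failures with factors tending to 1 have a limit
    pair that keeps both bounds [c] and violates [f_antiS]. *)
Lemma f_ratio (c : R) i : 0 < c -> exists2 rho, 1 < rho &
  forall p q, L p -> L q -> vle (F p) (F q) -> c <= p 0 i -> c <= q 0 i - p 0 i ->
    rho * f q 0 i <= f p 0 i.
Proof.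
move=> c0; apply: contrapT => no.
have ex (n : nat) : exists w : 'rV[R]_d * 'rV[R]_d, [/\ L w.1 /\ L w.2, vle (F w.1) (F w.2),
    c <= w.1 0 i, c <= w.2 0 i - w.1 0 i & f w.1 0 i <= (1 + n.+1%:R^-1) * f w.2 0 i].
  apply: contrapT => nw; apply: no; exists (1 + n.+1%:R^-1).
    by rewrite ltrDl invr_gt0 ltr0n.
  move=> p q pL qL pq cp cpq; rewrite leNgt; apply/negP => lt.
  by apply: nw; exists (p, q); split=> //; exact: ltW.
have [w wP] := choice ex.
have w1L n : L (w n).1 by case: (wP n) => -[].
have [p [phi [pL phiP up]]] := seq_compact L_compact w1L.
have w2L n : L (w (phi n)).2 by case: (wP (phi n)) => -[].
have [q [psi [qL psiP uq]]] := seq_compact L_compact w2L.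
have {}up : (fun n => (w (phi (psi n))).1) @ \oo --> p := cvg_subseq psiP up.
have uq' : (fun n => (w (phi (psi n))).2) @ \oo --> q := uq.
have C1 n := L_Cplus (w1L (phi (psi n))); have C2 n := L_Cplus (w2L (psi n)).
have Fpq : vle (F p) (F q).
  move=> j; have /cvg_rowP/(_ j) h1 := kolmogorov_seq f_cont C1 up.
  have /cvg_rowP/(_ j) h2 := kolmogorov_seq f_cont C2 uq'.
  by apply: (ler_cvg_to h1 h2); exists 0%N => // n _; case: (wP (phi (psi n))).
move/cvg_rowP/(_ i) : (up) => upi; move/cvg_rowP/(_ i) : (uq') => uqi.
have cp : c <= p 0 i.
  by apply: (cvgr_to_ge upi); exists 0%N => // n _; case: (wP (phi (psi n))).
have cpq : c <= q 0 i - p 0 i.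
  by apply: (cvgr_to_ge (cvgB uqi upi)); exists 0%N => // n _; case: (wP (phi (psi n))).
have := @f_antiS p q i (L_box pL) (L_box qL) Fpq (lt_le_trans c0 cp).
rewrite -subr_gt0 (lt_le_trans c0 cpq) => /(_ isT); apply/negP; rewrite -leNgt.
have fp : (fun n => f (w (phi (psi n))).1) @ \oo --> f p.
  exact: (seq_continuous f_cont C1 (L_Cplus pL) up).
have fq : (fun n => f (w (phi (psi n))).2) @ \oo --> f q.
  exact: (seq_continuous f_cont C2 (L_Cplus qL) uq').
move/cvg_rowP/(_ i) : fp => fp; move/cvg_rowP/(_ i) : fq => fq.
have h : (fun n => (1 + (phi (psi n)).+1%:R^-1) * f (w (phi (psi n))).2 0 i) @ \oo
    --> (1 + 0) * f q 0 i.
  apply: cvgM fq; apply: cvgD; first exact: cvg_cst.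
  have /= := cvg_subseq (phi := fun n => phi (psi n)) _ (@cvg_harmonic R).
  by apply => n; rewrite (leq_trans (psiP n)).
rewrite addr0 mul1r in h.
by apply: (ler_cvg_to fp h); exists 0%N => // n _; case: (wP (phi (psi n))).
Qed.

(* Along backward orbits of ordered points the ratio of the i-th coordinates
   decreases, by a uniform factor whenever the smaller one stays away from 0. *)
Lemma backward_cvg0 x y (c : R) : Gam x -> Gam y -> vle x y ->
  (forall i, 0 < x 0 i -> x 0 i < y 0 i) -> 0 < c ->
  exists N, forall n, (N <= n)%N -> forall i, iter n G x 0 i < c.
Proof.
move=> xG yG xy xyS c0.
suff ex i : exists N, forall n, (N <= n)%N -> iter n G x 0 i < c.
  have [N NP] := choice ex; exists (\max_i N i)%N => n Nn i; apply: NP.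
  by apply: leq_trans Nn; exact: leq_bigmax.
pose X n := iter n G x; pose Y n := iter n G y.
have XG n : Gam (X n) by exact: Gam_iterG.
have YG n : Gam (Y n) by exact: Gam_iterG.
have X0 n : 0 <= X n 0 i by exact: Gam_Cplus.
have [xi0|xi] := eqVneq (x 0 i) 0.
  by exists 0%N => n _; rewrite (iterG_eq0 n i xG).2.
have x0 : 0 < x 0 i by rewrite lt_neqAle eq_sym xi; exact: Gam_Cplus.
have y0 : 0 < y 0 i := lt_trans x0 (xyS i x0).
have Ypos n : 0 < Y n 0 i.
  rewrite lt_neqAle eq_sym (Gam_Cplus (YG n)) andbT; apply/eqP => /(iterG_eq0 n i yG) e.
  by rewrite e ltxx in y0.
pose r n := X n 0 i / Y n 0 i.
have r_ge0 n : 0 <= r n by rewrite divr_ge0// ltW.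
have FX n : F (X n.+1) = X n by rewrite /X /= Gam_FG//; exact: XG.
have FY n : F (Y n.+1) = Y n by rewrite /Y /= Gam_FG//; exact: YG.
have le n : vle (F (X n.+1)) (F (Y n.+1)) by rewrite FX FY; exact: iterG_le.
(* One backward step multiplies the ratio by [f (Y n.+1) / f (X n.+1)] in coordinate [i], which
   [f_anti] bounds by 1. *)
have rE n : r n * f (Y n.+1) 0 i = r n.+1 * f (X n.+1) 0 i.
  by rewrite /r -{1}(FX n) -{1}(FY n) !kolmogorovE ratio_kolmogorov// gt_eqF// (f_pos f_gt0)//; exact: Gam_Cplus.
have rS n : r n.+1 <= r n.
  apply: ratio_le (rE n); [|exact: (f_pos f_gt0 _ (Gam_Cplus (YG _)))|exact: r_ge0].
  by apply: f_anti (le n); exact/L_box/Gam_L.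
have r0 n : r n <= r 0%N by elim: n => // n; exact: le_trans.
have r01 : r 0%N < 1 by rewrite ltr_pdivrMr ?mul1r//; exact: xyS.
(* If [X_i >= c], the gap [Y_i - X_i] is at least [Y_i (1 - r 0)], hence at least [g]; as
   [Y_i <= b], the ratio is then at least [c / b]. *)
pose g := c * (1 - r 0%N).
have g0 : 0 < g by rewrite mulr_gt0 ?subr_gt0.
have gc : g <= c by rewrite ger_pMr// gerBl.
have [rho rho1 rhoP] := f_ratio i g0.
have cb0 : 0 < c / b by rewrite divr_gt0.
have [N NP] := nonincreasing_ratio r_ge0 rS cb0 rho1.
exists N.+1 => -[//|n]; rewrite ltnS => Nn; rewrite -/(X n.+1) ltNge; apply/negP => cX.
have XrY : X n.+1 0 i = r n.+1 * Y n.+1 0 i by rewrite /r divfK// gt_eqF.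
have cr : c / b <= r n.+1.
  rewrite ler_pdivrMr//; apply: le_trans cX _; rewrite XrY ler_wpM2l//.
  by have /boxP/(_ i)/andP[] := Gam_L (YG n.+1).
have XY : g <= Y n.+1 0 i - X n.+1 0 i.
  apply: (@le_trans _ _ (X n.+1 0 i * (1 - r 0%N))).
    by rewrite ler_wpM2r// subr_ge0 ltW.
  apply: (@le_trans _ _ (Y n.+1 0 i * (1 - r 0%N))).
    by rewrite ler_wpM2r ?subr_ge0 ?(ltW r01)//; apply: iterG_le.
  by rewrite mulrBr mulr1 lerB// XrY mulrC ler_wpM2l// ltW.
have fr := rhoP _ _ (Gam_L (XG n.+1)) (Gam_L (YG n.+1)) (le n) (le_trans gc cX) XY.
have fY0 : 0 < f (Y n.+1) 0 i := f_pos f_gt0 i (Gam_Cplus (YG _)).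
have [lt|] := NP n Nn; first by have := le_lt_trans (le_trans cr (rS n)) lt; rewrite ltxx.
apply/negP; rewrite -leNgt -(ler_pM2r fY0) rE mulrAC mulrC.
by rewrite ler_wpM2l// mulrC.
Qed.

Lemma core_of_strict del x y : small del -> Gam x -> Gam y -> vle x y ->
  (forall i, 0 < x 0 i -> x 0 i < y 0 i) -> ~ Sig del x.
Proof.
move=> sd xG yG xy xyS; rewrite notSigP//; have [d0 _ _] := sd.
have [N NP] := backward_cvg0 xG yG xy xyS d0.
by exists N; split=> [|i]; [exact/Gam_Cplus/Gam_iterG|exact: NP].
Qed.

(** Some backward iterate lies in [core], where a small box above it stays in [core], hence in
    [Gam]; [Gam_up] carries it forward to [x]. Together with [bump_notSig] this describes Sigma as
    the points of [Gam] with no room above them. *)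
Lemma notSig_bump del x : small del -> Gam x -> ~ Sig del x ->
  exists2 e : R, 0 < e & Gam (bump e x).
Proof.
move=> sd xG /(notSigP del xG)[n [u0 ud]].
set u := iter n G x in u0 ud; have uG : Gam u by exact: Gam_iterG.
rewrite -(Gam_iterFG n xG) -/u.
suff [e e0 ue] : exists2 e : R, 0 < e & core del (bump e u).
  by apply: (Gam_up (e := e)) => //; exact: core_Gam ue.
have [d0 _ _] := sd.
pose m := \big[Num.min/del]_i (del - u 0 i).
have m0 : 0 < m by apply: lt_bigmin => // i _; rewrite subr_gt0.
have mP i : m <= del - u 0 i by exact: bigmin_le_cond.
exists (m / 2); first by rewrite divr_gt0.
by split=> i; rewrite mxE; have := mP i; have := u0 i; lra.
Qed.

Lemma bump_notSig del x (e : R) : small del -> 0 < e -> Gam x -> Gam (bump e x) -> ~ Sig del x.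
Proof.
by move=> sd e0 xG xeG; apply: (core_of_strict sd xG xeG) => i; rewrite mxE ?lerDl ?ltrDl// ltW.
Qed.

Lemma notSig_cvg0 del x (c : R) : small del -> Gam x -> ~ Sig del x -> 0 < c ->
  exists N, forall n, (N <= n)%N -> forall i, iter n G x 0 i < c.
Proof.
move=> sd xG nS c0; have [e e0 xeG] := notSig_bump sd xG nS.
by apply: (backward_cvg0 xG xeG _ _ c0) => i; rewrite mxE ?lerDl ?ltrDl// ltW.
Qed.

(** Backward orbits of points off Sigma tend to 0 and so enter every small box. The freedom to
    shrink [del] is what gives attraction of sets close to 0. *)
Lemma Sig_small del del' : small del -> small del' -> Sig del = Sig del'.
Proof.
have sub e e' : small e -> small e' -> Sig e `<=` Sig e'.
  move=> se se' x xS; apply: contrapT => nS; have xG := Sig_Gam xS; have [e0 _ _] := se.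
  have [N NP] := notSig_cvg0 se' xG nS e0; apply/(notSigP e xG): xS.
  by exists N; split=> [|i]; [exact/Gam_Cplus/Gam_iterG|exact: NP].
by move=> sd sd'; apply/seteqP; split; exact: sub.
Qed.

Variable del : R.
Hypothesis small_del : small del.
Local Notation S := (Sig del).

Lemma L0 : L 0.
Proof. by apply/boxP => i; rewrite mxE lexx ltW. Qed.

Lemma iter_F0 n : iter n F 0 = 0.
Proof.
elim: n => //= n ->; apply/rowP => i.
by rewrite kolmogorovE mxE mul0r.
Qed.

Lemma iterF_eq0 n x i : Cplus x -> (iter n F x 0 i = 0) <-> (x 0 i = 0).
Proof.
move=> x0; elim: n => //= n IH; rewrite kolmogorov_eq0//.
exact: iter_Cplus.
Qed.

Lemma Gam0 : Gam 0.
Proof. by move=> n; exists 0; [exact: L0|exact: iter_F0]. Qed.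

Lemma Sig_F x : S x -> S (F x).
Proof. by apply: inv_part_F => //; exact: shell_F. Qed.

Lemma Sig_iterF n x : S x -> S (iter n F x).
Proof. by move=> xS; elim: n => //= n; exact: Sig_F. Qed.

Lemma Sig_G x : S x -> S (G x).
Proof. by move=> /(inv_part_G (@shell_L del) (shell_F small_del))[]. Qed.

Lemma Sig_iterG n x : S x -> S (iter n G x).
Proof. by move=> xS; elim: n => //= n; exact: Sig_G. Qed.

Lemma Sig_image : F @` S = S.
Proof. by apply: inv_part_image; [exact: shell_L|exact: shell_F]. Qed.

Lemma Sig_neq0 x : S x -> x <> 0.
Proof.
move=> /inv_part_sub[_ xd] x0; apply: xd; have [d0 _ _] := small_del.
by rewrite x0; split=> i; rewrite mxE.
Qed.

(** * Rays and asymptotic phases *)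

Lemma Gam_scale x a : Gam x -> 0 <= a <= 1 -> Gam (a *: x).
Proof.
move=> xG /andP[a0 a1]; have x0 := Gam_Cplus xG.
apply: (Gam_down xG) => i; rewrite mxE; first by rewrite mulr_ge0// x0.
by rewrite -[leRHS]mul1r ler_wpM2r// x0.
Qed.

Lemma scale_notSig x a : Gam x -> 0 <= a < 1 -> ~ S (a *: x).
Proof.
move=> xG /andP[a0 a1]; have x0 := Gam_Cplus xG.
have aG : Gam (a *: x) by apply: Gam_scale; rewrite // a0 ltW.
apply: (core_of_strict small_del aG xG) => i; rewrite mxE.
  by rewrite -[leRHS]mul1r ler_wpM2r ?x0// ltW.
move=> ax; have xi : 0 < x 0 i.
  rewrite lt_neqAle x0 andbT eq_sym; apply: contraTneq ax => ->.
  by rewrite mulr0 ltxx.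
by rewrite gtr_pMl.
Qed.

(** The largest multiple of [v] in [Gam] is in Sigma: otherwise [notSig_bump] leaves room for a
    larger one. *)
Lemma Sig_ray v : Cplus v -> v <> 0 -> exists2 a, 0 < a & S (a *: v).
Proof.
move=> v0 vn; have [i vi] : exists i, v 0 i <> 0.
  apply: contrapT => no; apply: vn; apply/rowP => i; rewrite mxE.
  by apply: contrapT => ?; apply: no; exists i.
have vi0 : 0 < v 0 i by rewrite lt_neqAle eq_sym; apply/andP; split; [exact/eqP|exact: v0].
pose E := [set a : R | 0 <= a /\ Gam (a *: v)].
have ubE : has_sup E.
  split; first by exists 0; split; rewrite ?scale0r//; exact: Gam0.
  exists (b / v 0 i) => a [a0 /Gam_L/boxP/(_ i)]; rewrite mxE => /andP[_].
  by rewrite ler_pdivlMr.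
have [s0 sG] : E (sup E).
  have ex (n : nat) : exists a, E a /\ sup E - n.+1%:R^-1 < a.
    have n0 : 0 < n.+1%:R^-1 :> R by rewrite invr_gt0 ltr0n.
    by have [a Ea ?] := sup_adherent n0 ubE; exists a.
  have [u uP] := choice ex.
  have us n : u n <= sup E by apply: ub_le_sup; [exact: ubE.2|case: (uP n)].
  have ucv : u @ \oo --> sup E.
    apply/cvgrPdist_lt => e e0; have [N _ NP] := near_infty_natSinv_lt (PosNum e0).
    exists N => // n /NP /= lt; rewrite ger0_norm ?subr_ge0//.
    by apply: le_lt_trans lt; have [_ /ltW] := uP n; rewrite lerBlDl -lerBlDr.
  split; first by apply: le_trans (us 0%N); have [[]] := uP 0%N.
  apply: (cvg_in_compact (u := fun n => u n *: v) Gam_compact).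
    by move=> n; have [[]] := uP n.
  exact: cvgZr_tmp.
have SS : S (sup E *: v).
  apply: contrapT => /(notSig_bump small_del sG)[e e0 eG].
  have V0 : 0 <= \sum_j v 0 j by apply: sumr_ge0 => j _; exact: v0.
  pose t := e / (1 + \sum_j v 0 j).
  have t0 : 0 < t by rewrite divr_gt0// ltr_pwDl.
  have : E (sup E + t).
    split; first by rewrite addr_ge0// ltW.
    apply: (Gam_down eG) => j; rewrite !mxE.
      by rewrite mulr_ge0 ?v0// addr_ge0// ltW.
    rewrite mulrDl lerD2l /t mulrAC ler_pdivrMr ?ltr_pwDl// ler_wpM2l ?(ltW e0)//.
    rewrite (bigD1 j)//= addrCA lerDl addr_ge0// sumr_ge0// => k _; exact: v0.
  by move=> /(ub_le_sup ubE.2); rewrite gerDl leNgt t0.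
exists (sup E) => //; rewrite lt_neqAle s0 andbT eq_sym; apply/eqP => s_eq.
by apply: (Sig_neq0 SS); rewrite s_eq scale0r.
Qed.

Lemma Sig_ray_unique v a a' : 0 <= a -> S (a *: v) -> S (a' *: v) -> a' <= a.
Proof.
move=> a0 Sa Sa'; rewrite leNgt; apply/negP => lt.
have a'0 : 0 < a' := le_lt_trans a0 lt.
apply: (@scale_notSig (a' *: v) (a / a')); first exact: Sig_Gam Sa'.
  by rewrite divr_ge0 ?(ltW a'0)// ltr_pdivrMr// mul1r.
by rewrite scalerA divfK// gt_eqF.
Qed.

(* The limit of the points F^-n(a_n F^n(x)), with a_n F^n(x) in Sig. *)
Lemma shadow_above x : Gam x -> x <> 0 -> exists2 y, S y &
  (forall i, x 0 i = 0 -> y 0 i = 0) /\ forall k, vle (iter k F x) (iter k F y).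
Proof.
move=> xG x0; have xL := Gam_L xG.
have xnG n : Gam (iter n F x) by elim: n => //= n; exact: Gam_F.
have ex n : exists s, [/\ S s, vle (iter n F x) s & forall i, x 0 i = 0 -> s 0 i = 0].
  have xn0 : iter n F x <> 0.
    move=> e; apply: x0; apply: (@iter_inj n) => //; first exact: L0.
    by rewrite e iter_F0.
  have [a a0 aS] := Sig_ray (Gam_Cplus (xnG n)) xn0.
  exists (a *: iter n F x); split=> // [i|i xi].
    rewrite mxE -[leLHS]mul1r ler_wpM2r ?(Gam_Cplus (xnG n))//.
    by rewrite leNgt; apply/negP => a1; apply: (scale_notSig (xnG n) _ aS); rewrite ltW.
  by rewrite mxE (iterF_eq0 n i (Gam_Cplus xG)).2 ?mulr0.
have [s sP] := choice ex.
pose y n := iter n G (s n).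
have yS n : S (y n) by apply: Sig_iterG; case: (sP n).
have [p [phi [pS phiP yp]]] := seq_compact (@Sig_compact del) yS.
exists p => //; split=> [i xi|k].
  move/cvg_rowP/(_ i) : yp; rewrite (_ : (fun n => _) = (fun=> 0)) => [h|].
    apply: (cvg_unique (@norm_hausdorff _ _) h); exact: cvg_cst.
  apply/funext => n /=; have [sS _ s0] := sP (phi n).
  by apply: (iterG_eq0 (phi n) i (Sig_Gam sS)).2; exact: s0.
have yC n : Cplus ((y \o phi) n) by apply/Gam_Cplus/Sig_Gam/yS.
have /cvg_rowP h := iter_seq (n := k) yC yp.
move=> i; apply: (cvgr_to_ge (h i)); exists k => // n /= kn.
have kphi : (k <= phi n)%N := leq_trans kn (phiP n).
have [sS xs _] := sP (phi n).
(* After [phi n - k] further iterations the comparison is between [F^(phi n) x] and [s (phi n)];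
   inverse monotonicity brings it back. *)
apply: (@iter_iso (phi n - k)); [exact/iter_L|exact/iter_L/Gam_L/Sig_Gam/yS|].
by rewrite -!iterD subnK// (Gam_iterFG _ (Sig_Gam sS)).
Qed.

(** Outside [Gam] the ray factor is at most 1, as [Gam] is downward closed, so the points of Sigma
    now lie below the orbit. Coordinates positive at [x] may vanish at [y], which rules out the
    ratios of [forward_asymptotic]. *)
Lemma shadow_below x : L x -> ~ Gam x -> exists2 y, S y &
  forall k, vle (iter k F y) (iter k F x).
Proof.
move=> xL xG.
have ex n : exists s, S s /\ vle s (iter n F x).
  have xnG : ~ Gam (iter n F x).
    move=> h; apply: xG; have h1 := Gam_iterG n h; rewrite (iter_GK n xL) in h1; exact: h1.
  have xn0 : iter n F x <> 0 by move=> e; apply: xnG; rewrite e; exact: Gam0.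
  have xnC := L_Cplus (iter_L n xL).
  have [a a0 aS] := Sig_ray xnC xn0.
  exists (a *: iter n F x); split=> // i.
  rewrite mxE -[leRHS]mul1r ler_wpM2r ?xnC//.
  rewrite leNgt; apply/negP => a1; apply: xnG; apply: (Gam_down (Sig_Gam aS)) => // j.
  by rewrite mxE -[leLHS]mul1r ler_wpM2r ?xnC// ltW.
have [s sP] := choice ex.
pose y n := iter n G (s n).
have yS n : S (y n) by apply: Sig_iterG; case: (sP n).
have [p [phi [pS phiP yp]]] := seq_compact (@Sig_compact del) yS.
exists p => // k.
have yC n : Cplus ((y \o phi) n) by apply/Gam_Cplus/Sig_Gam/yS.
have /cvg_rowP h := iter_seq (n := k) yC yp.
move=> i; apply: (cvgr_to_le (h i)); exists k => // n /= kn.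
have kphi : (k <= phi n)%N := leq_trans kn (phiP n).
have [sS xs] := sP (phi n).
apply: (@iter_iso (phi n - k)); [exact/iter_L/Gam_L/Sig_Gam/yS|exact/iter_L|].
by rewrite -!iterD subnK// (Gam_iterFG _ (Sig_Gam sS)).
Qed.

(** The ratios [Y_i / X_i] decrease and stay above 1, so a gap [c] cannot occur at late times: it
    would lower them by a uniform factor. Coordinates vanishing at [x] vanish along both orbits. *)
Lemma forward_asymptotic x y (c : R) : L x -> L y -> (forall i, x 0 i = 0 -> y 0 i = 0) ->
  (forall k, vle (iter k F x) (iter k F y)) -> 0 < c ->
  exists N, forall n, (N <= n)%N -> forall i, `|iter n F x 0 i - iter n F y 0 i| < c.
Proof.
move=> xL yL xy0 le c0.
suff ex i : exists N, forall n, (N <= n)%N -> `|iter n F x 0 i - iter n F y 0 i| < c.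
  have [N NP] := choice ex; exists (\max_i N i)%N => n Nn i; apply: NP.
  by apply: leq_trans Nn; exact: leq_bigmax.
pose X n := iter n F x; pose Y n := iter n F y.
have XL n : L (X n) by exact: iter_L.
have YL n : L (Y n) by exact: iter_L.
have [xi0|xi] := eqVneq (x 0 i) 0.
  exists 0%N => n _.
  by rewrite !(iterF_eq0 n i _).2 ?xy0 ?subrr ?normr0//; exact: L_Cplus.
have x0 : 0 < x 0 i by rewrite lt_neqAle eq_sym xi; exact: L_Cplus.
have Xpos n : 0 < X n 0 i.
  rewrite lt_neqAle eq_sym (L_Cplus (XL n)) andbT; apply: contra xi => /eqP e.
  by apply/eqP/(iterF_eq0 n i (L_Cplus xL)).
have Ypos n : 0 < Y n 0 i := lt_le_trans (Xpos n) (le n i).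
pose r n := Y n 0 i / X n 0 i.
have r_ge0 n : 0 <= r n by rewrite divr_ge0// ltW.
have rE n : r n.+1 * f (X n) 0 i = r n * f (Y n) 0 i.
  by rewrite /r /X /Y !iterS !kolmogorovE ratio_kolmogorov// gt_eqF// (f_pos f_gt0)//; exact: (L_Cplus (XL n)).
have rS n : r n.+1 <= r n.
  apply: ratio_le (esym (rE n)) => //; last exact: (f_pos f_gt0 _ (L_Cplus (YL _))).
  by apply: f_anti (le n.+1); exact/L_box.
have r0 n : r n <= r 0%N by elim: n => // n; exact: le_trans.
have r0_gt0 : 0 < r 0%N by rewrite divr_gt0// (Ypos 0%N).
have r1 n : 1 <= r n by rewrite ler_pdivlMr// mul1r; exact: le.
(* A gap [c] forces [Y_i >= c], and [Y_i] is at most [r 0] times [X_i], hence [X_i >= g]. *)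
pose g := c / r 0%N.
have g0 : 0 < g by rewrite divr_gt0.
have gc : g <= c by rewrite ler_pdivrMr// ler_peMr// ?r1// ltW.
have [rho rho1 rhoP] := f_ratio i g0.
have [N NP] := nonincreasing_ratio r_ge0 rS (ltr01 : 0 < 1 :> R) rho1.
exists N => n Nn; rewrite distrC ger0_norm ?subr_ge0; last exact: le.
rewrite -/(X n) -/(Y n) ltNge; apply/negP => cXY.
have XY : g <= X n 0 i.
  have cY : c <= Y n 0 i by have := Xpos n; lra.
  rewrite ler_pdivrMr//; apply: le_trans cY _.
  have -> : Y n 0 i = X n 0 i * r n by rewrite mulrC divfK// gt_eqF.
  by rewrite ler_wpM2l// ltW.
have fr := rhoP _ _ (XL n) (YL n) (le n.+1) XY (le_trans gc cXY).
have fX0 : 0 < f (X n) 0 i := f_pos f_gt0 i (L_Cplus (XL _)).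
have [|] := NP n Nn; first by rewrite ltNge r1.
apply/negP; rewrite -leNgt -(ler_pM2r fX0) -mulrA rE mulrCA.
by rewrite ler_wpM2l.
Qed.

(** Limits [p <= q] of the two orbits along a common subsequence both lie in Sigma, where only
    [p = q] is possible. *)
Lemma unordered_asymptotic x y (c : R) : unordered S -> shell del x -> S y ->
  (forall k, vle (iter k F y) (iter k F x)) -> 0 < c ->
  exists N, forall n, (N <= n)%N -> forall i, `|iter n F x 0 i - iter n F y 0 i| < c.
Proof.
move=> un xM yS le c0; apply: contrapT => no.
have ex N : exists m, (N <= m)%N /\ ~ forall i, `|iter m F x 0 i - iter m F y 0 i| < c.
  apply: contrapT => nm; apply: no; exists N => n Nn; apply: contrapT => ?.
  by apply: nm; exists n.
have [m mP] := choice ex.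
have yS' n : S (iter (m n) F y) by exact: Sig_iterF.
have [p [phi [pS phiP yp]]] := seq_compact (@Sig_compact del) yS'.
have xM' n : shell del (iter (m (phi n)) F x) by exact: (iter_M (shell_F small_del) _ xM).
have [q [psi [qM psiP xq]]] := seq_compact (@shell_compact del) xM'.
have qS : S q.
  apply: (@omega_inv_part _ (@shell_compact del) (@shell_L del) (shell_F small_del)
    (fun=> x) (fun n => m (phi (psi n)))) => // n.
  by rewrite (leq_trans (psiP n))// (leq_trans (phiP _))//; case: (mP (phi (psi n))).
have {}yp : (fun n => iter (m (phi (psi n))) F y) @ \oo --> p := cvg_subseq psiP yp.
have pq : vle p q.
  move=> i; move/cvg_rowP/(_ i) : yp => yp; move/cvg_rowP/(_ i) : xq => xq.
  by apply: (ler_cvg_to yp xq); apply: nearW => n; exact: le.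
have {pq}pq : p = q.
  by apply: contrapT => ne; apply: (un p q) => //; split.
subst q; have : \forall n \near \oo, forall i,
    `|iter (m (phi (psi n))) F x 0 i - iter (m (phi (psi n))) F y 0 i| < c.
  apply: filter_forall => i; move/cvg_rowP/(_ i) : yp => yp; move/cvg_rowP/(_ i) : xq => xq.
  have /cvgrPdist_lt/(_ c c0) : (fun n => iter (m (phi (psi n))) F x 0 i -
      iter (m (phi (psi n))) F y 0 i) @ \oo --> (0 : R).
    by rewrite -(subrr (p 0 i)); exact: cvgB.
  by apply: filterS => n; rewrite sub0r normrN.
by case=> N _ /(_ N (leqnn N)) /= al; have [_] := mP (phi (psi N)); apply.
Qed.

(** * Global attraction and the carrying simplex *)

Hypothesis F_abs : forall M : R, exists N, forall n x, (N <= n)%N ->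
  Cplus x -> (forall i, x 0 i <= M) -> L (iter n F x).
Hypothesis d_gt0 : (0 < d)%N.

Lemma inv_part_attracts_set M (e : R) : compact M -> M `<=` L -> (forall x, M x -> M (F x)) ->
  0 < e -> exists N, forall n x, (N <= n)%N -> M x -> edistance (iter n F x) (inv_part M) < e.
Proof.
move=> cM ML FM e0; have e'0 : 0 < e / d.+1%:R by rewrite divr_gt0.
have [N NP] := inv_part_attracts cM ML FM e'0.
exists N => n x Nn Mx; have [s sI sP] := NP n x Nn Mx.
by apply: (edistance_lt sI); apply: enorm_lt => // i; rewrite !mxE.
Qed.

Lemma Gam_compact_attractor : compact_attractor F Gam.
Proof.
split=> [| |x||A AC]; [|exact: Gam_compact|exact: Gam_Cplus|exact: inv_part_image|].
  by exists 0; exact: Gam0.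
move=> /bounded_setP[M MA] e e0.
have [N1 N1P] := F_abs M.
have [N2 N2P] := inv_part_attracts_set L_compact (fun=> id) F_L e0.
exists (N1 + N2)%N => n x Nn Ax.
have N1n : (N1 <= n)%N by rewrite (leq_trans _ Nn)// leq_addr.
rewrite -(subnK N1n) iterD; apply: N2P; first by rewrite leq_subRL.
by apply: N1P (AC _ Ax) _ => // i; rewrite (le_trans (ler_norm _))// MA.
Qed.

Lemma f_bounds (M : R) : exists m m', [/\ 0 < m, 0 < m' & forall x, Cplus x ->
  (forall i, x 0 i <= M) -> forall i, m <= f x 0 i <= m'].
Proof.
apply: contrapT => no.
have ex (n : nat) : exists x, [/\ Cplus x, forall i, x 0 i <= M &
    ~ forall i, n.+1%:R^-1 <= f x 0 i <= n.+1%:R].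
  apply: contrapT => nx; apply: no; exists n.+1%:R^-1, n.+1%:R; split.
  - by rewrite invr_gt0 ltr0n.
  - by rewrite ltr0n.
  by move=> x x0 xM; apply: contrapT => ?; apply: nx; exists x.
have [u uP] := choice ex.
have uB n : vitv 0 (M *: ones) (u n).
  by have [u0 uM _] := uP n; apply/boxP => i; rewrite u0 uM.
have [p [phi [pB phiP up]]] := seq_compact (@box_compact R d M) uB.
have p0 : Cplus p by case: pB.
have uC n : Cplus ((u \o phi) n) by case: (uP (phi n)).
have fu : (fun n => f (u (phi n))) @ \oo --> f p := seq_continuous f_cont uC p0 up.
have : \forall n \near \oo, forall i, n.+1%:R^-1 <= f (u (phi n)) 0 i <= n.+1%:R.
  apply: filter_forall => i; move/cvg_rowP/(_ i) : fu => fu.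
  have fp := f_pos f_gt0 i p0.
  have fp2 : f p 0 i / 2 < f p 0 i by lra.
  have fp1 : f p 0 i < f p 0 i + 1 by lra.
  have fp3 : 0 < f p 0 i / 2 by lra.
  move/cvgr_gt : (fu) => /(_ _ fp2) h1; move/cvgr_lt : (fu) => /(_ _ fp1) h2.
  have h3 := near_infty_natSinv_lt (PosNum fp3).
  have h4 : \forall n \near \oo, f p 0 i + 1 <= n.+1%:R.
    have := nbhs_infty_ger (f p 0 i + 1); apply: filterS => n le.
    by apply: le_trans le _; rewrite ler_nat.
  near=> n; apply/andP; split.
    apply: ltW; apply: (@lt_trans _ _ (f p 0 i / 2)); last by near: n.
    by near: n.
  apply: (@le_trans _ _ (f p 0 i + 1)); last by near: n.
  by apply: ltW; near: n.
case=> N _ /(_ N (leqnn N)) /= al; have [_ _] := uP (phi N); apply => i.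
have /andP[h1 h2] := al i; have Np := phiP N.
apply/andP; split; [apply: le_trans h1|apply: le_trans h2 _; rewrite ler_nat ltnS//].
by rewrite lef_pV2 ?posrE ?ltr0n// ler_nat ltnS.
Unshelve. all: by end_near. Qed.

(** On bounded sets each step multiplies coordinates by factors bounded above and away from 0; the
    induction enlarges [M] and adjusts [c] accordingly. *)
Lemma iter_away n (M c : R) : 0 < c -> exists2 c', 0 < c' & forall x, Cplus x ->
  (forall i, x 0 i <= M) -> (exists i, c <= x 0 i) -> exists i, c' <= iter n F x 0 i.
Proof.
elim: n M c => [|n IH] M c c0; first by exists c.
have [m [m' [m0 m'0 mP]]] := f_bounds M.
have [c' c'0 c'P] := IH (`|M| * m') (c * m) (mulr_gt0 c0 m0).
exists c' => // x x0 xM [i cx]; rewrite iterSr; apply: c'P.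
- exact: kolmogorov_Cplus.
- move=> j; rewrite kolmogorovE; have /andP[h1 h2] := mP x x0 xM j.
  apply: ler_pM; [exact: x0|exact: le_trans (ltW m0) h1| |exact: h2].
  exact: le_trans (xM j) (ler_norm _).
- exists i; rewrite kolmogorovE; have /andP[h1 h2] := mP x x0 xM i.
  by apply: ler_pM => //; exact: ltW.
Qed.

Lemma Sig_attracts A : A `<=` Cplus -> bounded_set A -> ~ closure A 0 -> attracts F S A.
Proof.
move=> AC /bounded_setP[M MA] cl0 e e0.
have AM x : A x -> forall i, x 0 i <= M by move=> Ax i; rewrite (le_trans (ler_norm _))// MA.
have [c c0 cA] : exists2 c : R, 0 < c & forall x, A x -> exists i, c <= x 0 i.
  apply: contrapT => no; apply: cl0 => B /nbhs_ballP[r /= r0 rB].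
  have r20 : 0 < r / 2 by rewrite divr_gt0.
  apply: contrapT => nB; apply: no; exists (r / 2) => // x Ax.
  apply: contrapT => nx; apply: nB; exists x; split=> //; apply: rB.
  rewrite -ball_normE /= sub0r normrN; apply: (@le_lt_trans _ _ (r / 2)); last by lra.
  apply: normr_le_coord => [|i]; first exact: ltW.
  rewrite ger0_norm; last exact: AC.
  by rewrite leNgt; apply/negP => lt; apply: nx; exists i; exact: ltW.
have [N1 N1P] := F_abs M.
have [c' c'0 c'P] := iter_away N1 M c0.
have [d0 db dP] := small_del.
(* Shrinking the removed box to side at most [c'] leaves Sigma unchanged and puts the late images of
   [A] in the shell. *)
have se : small (Num.min del c').
  by apply: (smallS small_del); rewrite ?lt_min ?d0// ge_min lexx.
rewrite (Sig_small small_del se).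
have [N2 N2P] := inv_part_attracts_set (@shell_compact _) (@shell_L _) (shell_F se) e0.
exists (N1 + N2)%N => n x Nn Ax.
have N1n : (N1 <= n)%N by rewrite (leq_trans _ Nn)// leq_addr.
rewrite -(subnK N1n) iterD; apply: N2P; first by rewrite leq_subRL.
split; first exact: N1P (AC _ Ax) (AM _ Ax).
move=> [_ lt]; have [i le] := c'P x (AC _ Ax) (AM _ Ax) (cA x Ax).
by have := lt i; rewrite lt_min => /andP[_]; rewrite ltNge le.
Qed.

Lemma Sig_weakly_unordered : weakly_unordered S.
Proof.
move=> I I0 x y [xS [x0 xI]] [yS [y0 yI]] xy lt.
apply: (core_of_strict small_del (Sig_Gam xS) (Sig_Gam yS)) xS => i.
  have [iI|iI] := boolP (i \in I); first exact/ltW/lt.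
  by rewrite xI// yI.
have [iI _|iI] := boolP (i \in I); first exact: lt.
by rewrite xI// ltxx.
Qed.

(** Either alternative makes the preimages [G x <= G y] strictly ordered at each positive
    coordinate, so [core_of_strict] excludes [G x] from Sigma. In the second, equal positive [i]-th
    coordinates of the preimages would give [y i < x i]. *)
Lemma Sig_unordered :
  (forall x y, Gam x -> Gam y -> vlt (F x) (F y) -> forall i, 0 < y 0 i -> x 0 i < y 0 i) \/
  (forall x y, Cplus x -> Cplus y -> vlt x y -> forall i, f x 0 i > f y 0 i) ->
  unordered S.
Proof.
move=> str x y xS yS xy [le _].
have pS := Sig_G xS; have qS := Sig_G yS; have pG := Sig_Gam pS; have qG := Sig_Gam qS.
have Fp := Gam_FG (Sig_Gam xS); have Fq := Gam_FG (Sig_Gam yS).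
have pq : vle (G x) (G y) := @iterG_le 1 _ _ (Sig_Gam xS) (Sig_Gam yS) le.
apply: (core_of_strict small_del pG qG pq) pS => i pi.
case: str => h; first by apply: h; rewrite ?Fp ?Fq//; exact: lt_le_trans pi (pq i).
rewrite lt_neqAle pq andbT; apply/eqP => e.
have pq' : vlt (G x) (G y) by split=> // eG; apply: xy; rewrite -Fp -Fq eG.
have := le i; rewrite -Fp -Fq !kolmogorovE -e ler_pM2l// leNgt.
by rewrite h//; exact: Gam_Cplus.
Qed.

Lemma Sig_radial : homeo_on S std_simplex radial_proj.
Proof.
have SC x : S x -> Cplus x by move/Sig_Gam/Gam_Cplus.
have l1E x : Cplus x -> l1norm x = \sum_i x 0 i.
  by move=> x0; apply: eq_bigr => i _; rewrite ger0_norm// x0.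
have radK x : x <> 0 -> l1norm x *: radial_proj x = x.
  by move=> x0; rewrite /radial_proj scalerA divff ?scale1r// gt_eqF// l1norm_gt0.
have -> : std_simplex = radial_proj @` S.
  apply/seteqP; split=> [v [v0 v1]|_ [x xS <-]].
    have vn : v <> 0.
      by move=> e; move: v1; rewrite e big1 => [/esym/eqP|i _]; rewrite ?oner_eq0 ?mxE.
    have [a a0 aS] := Sig_ray v0 vn; exists (a *: v) => //.
    rewrite /radial_proj l1normZ ?(ltW a0)// l1E// v1 mulr1 scalerA mulVf ?scale1r//.
    by rewrite gt_eqF.
  have x0 := SC _ xS; have l0 := l1norm_gt0 (Sig_neq0 xS).
  split=> [i|]; first by rewrite mxE mulr_ge0 ?x0// invr_ge0 ltW.
  under eq_bigr do rewrite mxE.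
  by rewrite -mulr_sumr -l1E// mulVf// gt_eqF.
apply: homeo_on_compact; first exact: Sig_compact.
  apply: within_continuous_seq => u p uS pS up; rewrite /radial_proj.
  apply: cvgZ => //; apply: cvgV; first by rewrite gt_eqF// l1norm_gt0//; exact: Sig_neq0.
  exact: l1norm_cvg.
move=> x y xS yS e.
have xE := radK x (Sig_neq0 xS); have yE := radK y (Sig_neq0 yS).
rewrite -xE -yE -e; congr (_ *: _).
have l0 z : 0 <= l1norm z :> R by apply: sumr_ge0.
by apply/eqP; rewrite eq_le; apply/andP; split;
  apply: (@Sig_ray_unique (radial_proj x)); rewrite ?l0// ?xE// {1}e yE.
Qed.

Lemma Sig_homeo : homeo_on S S F.
Proof.
rewrite -{2}Sig_image; apply: homeo_on_compact; first exact: Sig_compact.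
  apply: within_continuous_seq => u p uS _ up.
  by apply: (kolmogorov_seq f_cont _ up) => n; exact/Gam_Cplus/Sig_Gam/uS.
by move=> x y xS yS; apply: F_inj; exact/L_box/Gam_L/Sig_Gam.
Qed.

Lemma Gam_asymptotic x : Gam x -> x <> 0 -> exists2 y, S y & asymptotic F x y.
Proof.
move=> xG x0; have [y yS [y0 le]] := shadow_above xG x0; exists y => //.
by apply: asymptoticP => c; apply: forward_asymptotic => //; apply: Gam_L => //; exact: Sig_Gam yS.
Qed.

(** Finitely many steps bring the orbit into [L]; a phase found there is moved back by [G] inside
    Sigma. *)
Lemma unordered_Sig_asymptotic x : unordered S -> Cplus x -> x <> 0 ->
  exists2 y, S y & asymptotic F x y.
Proof.
move=> un xC x0.
have [N NP] := F_abs (\sum_i x 0 i).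
have xNL : L (iter N F x).
  apply: NP => // i; rewrite (bigD1 i)//= lerDl sumr_ge0// => j _; exact: xC.
have xN0 : iter N F x <> 0.
  move=> e; apply: x0; apply/rowP => i; rewrite mxE.
  by apply/(iterF_eq0 N i xC); rewrite e mxE.
suff [z zS za] : exists2 z, S z & asymptotic F (iter N F x) z.
  exists (iter N G z); first exact: Sig_iterG.
  rewrite /asymptotic -(cvg_shiftn N); move: za; rewrite /asymptotic.
  apply: cvg_trans; apply: near_eq_cvg; apply: nearW => n /=.
  by rewrite !iterD Gam_iterFG//; exact: Sig_Gam.
have [xG|xG] := pselect (Gam (iter N F x)); first exact: Gam_asymptotic.
have [z zS le] := shadow_below xNL xG; exists z => //.
apply: asymptoticP => c c0; apply: unordered_asymptotic => //.
by split=> // /(core_Gam small_del).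
Qed.

Lemma Sig_weak_carrying_simplex : weak_carrying_simplex F S.
Proof.
exists Gam; split; first exact: Gam_compact_attractor.
split; [by split; [exact: Sig_weakly_unordered|exact: Sig_Gam]|exact: Sig_radial| | |].
- by split; [exact: Sig_image|exact: Sig_homeo].
- exact: Sig_attracts.
- exact: Gam_asymptotic.
Qed.

Lemma Sig_carrying_simplex : unordered S -> carrying_simplex F S.
Proof.
move=> un; exists Gam; split; first exact: Gam_compact_attractor.
split; [by split; [|exact: Sig_Gam]|exact: Sig_radial| | |].
- by split; [exact: Sig_image|exact: Sig_homeo].
- exact: Sig_attracts.
- by move=> x; exact: unordered_Sig_asymptotic.
Qed.

(** * Boundary, orbits and projection *)

(** Being downward closed, [Gam] is a neighbourhood of [x] in [Cplus] exactly when it contains some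
    [bump e x] with [e > 0]. *)
Lemma Sig_boundary : S = rel_boundary Cplus Gam.
Proof.
have [d0 _ _] := small_del.
apply/seteqP; split=> [x xS|x [[x0 clx] clnx]].
  have xG := Sig_Gam xS; have x0 := Gam_Cplus xG.
  split; first by split=> //; apply: subset_closure; split.
  move=> B /nbhs_ballP[r /= r0 rB].
  have r20 : 0 < r / 2 by rewrite divr_gt0.
  exists (bump (r / 2) x); split.
    split; first by move=> i; rewrite mxE addr_ge0// ?ltW// x0.
    by move=> bG; apply: (bump_notSig small_del r20 xG bG).
  apply: rB; rewrite -ball_normE /=; apply: (@le_lt_trans _ _ (r / 2)); last by lra.
  apply: normr_le_coord => [|i]; first exact: ltW.
  by rewrite !mxE opprD addrA subrr sub0r normrN gtr0_norm.
have xG : Gam x.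
  have clG : closed Gam by apply: compact_closed Gam_compact; exact: norm_hausdorff.
  by apply: clG; move: clx; apply: closure_subset => y [].
apply: contrapT => /(notSig_bump small_del xG)[e e0 eG].
have [y [[y0 nyG] xy]] := clnx _ (nbhsx_ballx x e e0).
apply: nyG; apply: Gam_down eG y0 _ => i; rewrite mxE.
move: xy; rewrite -ball_normE /= => xy.
have := le_lt_trans (normr_coord_le (x - y) i) xy; rewrite !mxE ltr_norml => /andP[h1 h2].
lra.
Qed.

Lemma Gam_order_convex : order_convex Gam.
Proof. by move=> x y xG yG _ z [z0 _ zy]; exact: Gam_down yG z0 zy. Qed.

Lemma ex_Sig : exists x, S x.
Proof.
have one0 : Cplus (const_mx 1 : 'rV[R]_d) by move=> i; rewrite mxE ler01.
have one_neq0 : const_mx 1 <> 0 :> 'rV[R]_d.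
  by move=> /rowP/(_ (Ordinal d_gt0))/eqP; rewrite !mxE oner_eq0.
by have [a _ aS] := Sig_ray one0 one_neq0; exists (a *: const_mx 1).
Qed.

Lemma Gam_diff_Sig : Gam `\` S = [set z | exists a x, [/\ 0 <= a < 1, S x & z = a *: x]].
Proof.
apply/seteqP; split=> [z [zG nS]|z [a [x [a01 xS ->]]]]; last first.
  split; last by apply: scale_notSig => //; exact: Sig_Gam.
  by apply: Gam_scale; [exact: Sig_Gam|case/andP: a01 => -> /ltW].
have [->|/eqP z0] := eqVneq z 0.
  have [s sS] := ex_Sig; exists 0, s; split=> //; first by rewrite lexx ltr01.
  by rewrite scale0r.
have [a a0 aS] := Sig_ray (Gam_Cplus zG) z0.
exists a^-1, (a *: z); split=> //; last by rewrite scalerA mulVf ?scale1r// gt_eqF.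
rewrite invr_ge0 (ltW a0)/= invf_lt1// ltNge le_eqVlt; apply/negP => /orP[/eqP a1|a1].
  by apply: nS; rewrite -[z]scale1r -a1.
by apply: (scale_notSig zG _ aS); rewrite a1 ltW.
Qed.

Lemma Gam_cone : Gam = [set z | exists a x, [/\ 0 <= a <= 1, S x & z = a *: x]].
Proof.
apply/seteqP; split=> [z zG|z [a [x [a01 xS ->]]]]; last by apply: Gam_scale; first exact: Sig_Gam.
have [zS|nS] := pselect (S z); first by exists 1, z; rewrite scale1r ler01 lexx.
have : (Gam `\` S) z by []; rewrite Gam_diff_Sig => -[a [x [/andP[a0 a1] xS ->]]].
by exists a, x; rewrite a0 (ltW a1).
Qed.

(** Each [u n] is the [N]-th image of the bounded point [u (N + n)], so absorption puts the whole
    orbit in [L], where injectivity leaves no choice but [G]. *)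
Lemma backward_orbit_Gam x (u : nat -> 'rV[R]_d) : backward_orbit F x u -> bounded_set (range u) ->
  Gam x /\ forall n, u n = iter n G x.
Proof.
move=> [<- uC uF] /bounded_setP[M MA].
have uFn n k : iter k F (u (k + n)%N) = u n.
  by elim: k => // k IH; rewrite addSn iterSr uF.
have [N NP] := F_abs M.
have uL n : L (u n).
  rewrite -(uFn n N); apply: NP => // i.
  by rewrite (le_trans (ler_norm _))//; apply: MA; exists (N + n)%N.
have uF0 n : iter n F (u n) = u 0%N by have := uFn 0%N n; rewrite addn0.
have u0G : Gam (u 0%N) by move=> n; exists (u n).
split=> // n; apply: (@iter_inj n) => //; first exact/Gam_L/Gam_iterG.
by rewrite Gam_iterFG.
Qed.

Lemma iterG_backward_orbit x : Gam x -> backward_orbit F x (fun n => iter n G x).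
Proof.
move=> xG; split=> // n; first exact/Gam_Cplus/Gam_iterG.
by rewrite iterS Gam_FG//; exact: Gam_iterG.
Qed.

Lemma Gam_diff_Sig_backward : Gam `\` S = [set x | Cplus x /\
  exists2 u, backward_orbit F x u & u @ \oo --> (0 : 'rV[R]_d)].
Proof.
have [d0 _ _] := small_del.
apply/seteqP; split=> [x [xG nS]|x [x0 [u ux u0]]].
  split; first exact: Gam_Cplus.
  exists (fun n => iter n G x); first exact: iterG_backward_orbit.
  apply/cvg_rowP => i; rewrite mxE; apply/cvgrPdist_lt => e e0.
  have [N NP] := notSig_cvg0 small_del xG nS e0; exists N => // n Nn /=.
  rewrite sub0r normrN ger0_norm ?NP//; exact: (Gam_Cplus (Gam_iterG n xG)).
have bu : bounded_set (range u).
  apply/bounded_setP.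
  have [M [_ /(_ (M + 1))]] := cvg_seq_bounded (cvgP _ u0).
  rewrite ltrDl => /(_ ltr01) MP; exists (M + 1) => _ [n _ <-] i.
  by apply: le_trans (normr_coord_le _ i) _; exact: MP.
have [xG uE] := backward_orbit_Gam ux bu.
split=> //; apply/(notSigP del xG).
have : \forall n \near \oo, forall i, u n 0 i < del.
  apply: filter_forall => i; move/cvg_rowP/(_ i) : u0; rewrite mxE => /cvgr_lt; exact.
case=> N _ /(_ N (leqnn N)) /= al; exists N; rewrite -uE; split=> //.
by case: ux.
Qed.

Lemma Sig_total_orbit : S = [set x | Cplus x /\
  exists2 A, total_orbit F x A & bounded_set A /\ bounded_away_from_0 A].
Proof.
have [d0 _ _] := small_del.
apply/seteqP; split=> [x xS|x [x0 [_ [u ux ->] [bA [e e0 eA]]]]].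
  have xG := Sig_Gam xS; split; first exact: Gam_Cplus.
  exists (range (fun n => iter n G x) `|` range (fun n => iter n F x)).
    by exists (fun n => iter n G x) => //; exact: iterG_backward_orbit.
  have sub : range (fun n => iter n G x) `|` range (fun n => iter n F x) `<=` S.
    by move=> _ [[n _ <-]|[n _ <-]]; [exact: Sig_iterG|exact: Sig_iterF].
  split.
    exact: bounded_subset sub (compact_bounded (@Sig_compact del)).
  exists del => // y /sub /inv_part_sub [yL yd]; rewrite leNgt; apply/negP => lt.
  apply: yd; split=> [|i]; first exact: L_Cplus.
  by apply: le_lt_trans lt; apply: le_trans (normr_coord_le_enorm _ i); exact: ler_norm.
have bu : bounded_set (range u).
  by apply: bounded_subset bA => y ?; left.
have [xG uE] := backward_orbit_Gam ux bu.
apply: contrapT => nS; have e'0 : 0 < e / d.+1%:R by rewrite divr_gt0.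
have [N NP] := notSig_cvg0 small_del xG nS e'0.
have : e <= enorm (u N) by apply: eA; left; exists N.
rewrite leNgt => /negP; apply; apply: enorm_lt => // i; rewrite uE ger0_norm ?NP//.
exact: (Gam_Cplus (Gam_iterG N xG)).
Qed.

Lemma Sig_orth_proj : orth_proj_inv_lipschitz S.
Proof.
apply: orth_proj_lipschitz => // x y xS yS lt.
by apply: (core_of_strict small_del (Sig_Gam xS) (Sig_Gam yS)) xS => i; [exact/ltW/lt|move=> _; exact: lt].
Qed.

Theorem core_conclusion (Gam' : set 'rV[R]_d) : compact_attractor F Gam' ->
  [/\ [/\ S = rel_boundary Cplus Gam', order_convex Gam' &
          Gam' = [set z | exists a x, [/\ 0 <= a <= 1, S x & z = a *: x]]],
      Gam' `\` S = [set z | exists a x, [/\ 0 <= a < 1, S x & z = a *: x]] /\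
      Gam' `\` S = [set x | Cplus x /\
        exists2 u, backward_orbit F x u & u @ \oo --> (0 : 'rV[R]_d)],
      S = [set x | Cplus x /\
        exists2 A, total_orbit F x A & bounded_set A /\ bounded_away_from_0 A] &
      orth_proj_inv_lipschitz S].
Proof.
move=> /(compact_attractor_unique Gam_compact_attractor) <-; split.
- by split; [exact: Sig_boundary|exact: Gam_order_convex|exact: Gam_cone].
- by split; [exact: Gam_diff_Sig|exact: Gam_diff_Sig_backward].
- exact: Sig_total_orbit.
- exact: Sig_orth_proj.
Qed.

End Core.

(** * Reduction of the two conditions to inverse monotonicity *)

Section Reduction.
Context {R : realType} {d : nat}.
Implicit Types (x y : 'rV[R]_d).
Variable f : 'rV[R]_d -> 'rV[R]_d.
Local Notation F := (kolmogorov f).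
Hypothesis f_cont : {within Cplus, continuous f}.
Hypothesis f_gt0 : forall x, Cplus x -> vll 0 (f x).
Hypothesis f_axis : forall i : 'I_d, f (delta_mx 0 i) 0 i = 1.

(* The common content of conditions (alpha) and (beta) on [Lam k]. *)
Definition inverse_monotone (k : R) :=
  [/\ local_homeo_on (Lam k) F, weakly_retrotone F (Lam k) &
      forall x y, Lam k x -> Lam k y -> vlt (F x) (F y) ->
        (forall i, f y 0 i <= f x 0 i) /\
        (forall i, F x 0 i < F y 0 i -> x 0 i = 0 \/ f y 0 i < f x 0 i)].

Lemma LamP (k : R) x : Lam k x <-> forall i, 0 <= x 0 i <= 1 + k.
Proof. exact: boxP. Qed.

Lemma Lam_Cplus (k : R) x : Lam k x -> Cplus x. Proof. by case. Qed.

Lemma vle_vlt x y i : vle x y -> x 0 i < y 0 i -> vlt x y.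
Proof. by move=> xy lt; split=> // e; rewrite e ltxx in lt. Qed.

Lemma alpha_inverse_monotone : condition_alpha f -> exists2 k, 0 < k & inverse_monotone k.
Proof.
move=> [[k k0 [lh wr]] mono]; exists k => //; split=> // x y xL yL Fxy.
have [xy _] := wr finset.set0 x y xL yL Fxy (fun i => ltac:(by rewrite finset.in_set0)).
have [h1 h2] := mono x y (Lam_Cplus xL) (Lam_Cplus yL) xy; split=> [i|i lt]; first exact: h1.
right; apply: h2; have [|_] := wr (finset.set1 i) x y xL yL Fxy.
  by move=> j; rewrite finset.in_set1 => /eqP->.
by apply; rewrite finset.in_set1.
Qed.

Lemma beta_inverse_monotone k : condition_beta f -> 0 < k -> inverse_monotone k.
Proof. by move=> h /h[]. Qed.

Section InverseMonotone.
Variable k : R.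
Hypothesis k_gt0 : 0 < k.
Hypothesis fk : inverse_monotone k.

Lemma Lam_inj x y : Lam k x -> Lam k y -> F x = F y -> x = y.
Proof.
have [lh _ _] := fk.
apply: local_homeo_inj lh _ _ x y; first exact: box_compact.
- by apply: continuous_subspaceW (kolmogorov_cont f_cont) => x [].
- move=> x t /LamP xL /andP[t0 t1]; apply/LamP => i; have /andP[x0 xk] := xL i.
  rewrite mxE mulr_ge0//= (le_trans _ xk)//.
  by rewrite -[leRHS]mul1r ler_wpM2r.
- move=> x [x0 _ _] e; apply/rowP => i; rewrite mxE.
  by apply/(kolmogorov_eq0 f_gt0 i x0); rewrite e kolmogorovE mxE mul0r.
Qed.

Lemma Lam_iso x y : Lam k x -> Lam k y -> vle (F x) (F y) -> vle x y.
Proof.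
move=> xL yL /vleP[/(Lam_inj xL yL)->//|lt].
have [_ wr _] := fk.
by have [[]] := wr finset.set0 x y xL yL lt (fun i => ltac:(by rewrite finset.in_set0)).
Qed.

Lemma Lam_isoS x y i : Lam k x -> Lam k y -> vle (F x) (F y) ->
  F x 0 i < F y 0 i -> x 0 i < y 0 i.
Proof.
move=> xL yL le lt; have [_ wr _] := fk.
have [|_] := wr (finset.set1 i) x y xL yL (vle_vlt le lt).
  by move=> j; rewrite finset.in_set1 => /eqP->.
by apply; rewrite finset.in_set1.
Qed.

Lemma Lam_anti x y i : Lam k x -> Lam k y -> vle (F x) (F y) -> f y 0 i <= f x 0 i.
Proof.
move=> xL yL /vleP[/(Lam_inj xL yL)->//|lt].
by have [_ _ /(_ x y xL yL lt)[]] := fk.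
Qed.

(** If the [i]-th images agree, [x i < y i] alone orders the factors; otherwise the strict clause
    applies. *)
Lemma Lam_antiS x y i : Lam k x -> Lam k y -> vle (F x) (F y) ->
  0 < x 0 i -> x 0 i < y 0 i -> f y 0 i < f x 0 i.
Proof.
move=> xL yL le x0 xy; have := le i; rewrite le_eqVlt => /orP[/eqP e|lt]; last first.
  have [_ _ /(_ x y xL yL (vle_vlt le lt))[_ /(_ i lt)]] := fk.
  by case=> // e; rewrite e ltxx in x0.
have fx := f_pos f_gt0 i (Lam_Cplus xL); have y0 := lt_trans x0 xy.
by rewrite -(ltr_pM2l y0) -kolmogorovE -e kolmogorovE ltr_pM2r.
Qed.

Definition axis i (t : R) : 'rV[R]_d := t *: delta_mx 0 i.

Lemma axisE i t j : axis i t 0 j = if j == i then t else 0.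
Proof. by rewrite !mxE eqxx /=; case: eqP; rewrite (mulr1, mulr0). Qed.

Lemma axis_Cplus i t : 0 <= t -> Cplus (axis i t).
Proof. by move=> t0 j; rewrite axisE; case: ifP. Qed.

Lemma axis_Lam i t : 0 <= t <= 1 + k -> Lam k (axis i t).
Proof.
by move=> t01; apply/LamP => j; rewrite axisE; case: ifP => // _; rewrite lexx addr_ge0// ltW.
Qed.

Lemma kolmogorov_axis i t x : F (axis i t) 0 i <= F x 0 i -> Cplus x -> vle (F (axis i t)) (F x).
Proof.
move=> le x0 j; have [->//|ji] := eqVneq j i.
by rewrite kolmogorovE axisE (negbTE ji) mul0r; exact: (kolmogorov_Cplus f_gt0 x0).
Qed.

(** Images of points on one axis are always comparable, so inverse monotonicity turns into
    monotonicity of [F]. *)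
Lemma axis_mono i s t : 0 <= s -> s <= t -> t <= 1 + k -> F (axis i s) 0 i <= F (axis i t) 0 i.
Proof.
move=> s0 st tk; rewrite leNgt; apply/negP => lt.
have t0 := le_trans s0 st; have sk := le_trans st tk.
have := Lam_isoS (axis_Lam i _) (axis_Lam i _) (kolmogorov_axis (ltW lt) (axis_Cplus i s0)) lt.
by rewrite t0 s0 tk sk !axisE eqxx ltNge st => /(_ isT isT).
Qed.

Lemma axis_anti i s t : 0 <= s -> s <= t -> t <= 1 + k -> f (axis i t) 0 i <= f (axis i s) 0 i.
Proof.
move=> s0 st tk; have t0 := le_trans s0 st; have sk := le_trans st tk.
apply: Lam_anti; [by apply: axis_Lam; rewrite s0|by apply: axis_Lam; rewrite t0|].
by apply: kolmogorov_axis; [exact: axis_mono|exact: axis_Cplus].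
Qed.

Lemma axis_antiS i s t : 0 < s -> s < t -> t <= 1 + k -> f (axis i t) 0 i < f (axis i s) 0 i.
Proof.
move=> s0 st tk; have t0 := lt_trans s0 st; have sk := le_trans (ltW st) tk.
apply: Lam_antiS; rewrite ?axisE ?eqxx//.
- by apply: axis_Lam; rewrite ltW.
- by apply: axis_Lam; rewrite ltW.
apply: kolmogorov_axis; last by apply: axis_Cplus; exact: ltW.
by apply: axis_mono => //; exact: ltW.
Qed.

Lemma f_axis1 i : f (axis i 1) 0 i = 1. Proof. by rewrite /axis scale1r f_axis. Qed.

(** The detour through [2^-1] avoids the coordinate 0, where strict decrease is not provided. *)
Lemma f0_gt1 i : 1 < f 0 0 i.
Proof.
rewrite -[ltLHS](f_axis1 i) (_ : 0 = axis i 0); last by rewrite /axis scale0r.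
have k0 := k_gt0.
apply: (@lt_le_trans _ _ (f (axis i 2^-1) 0 i)).
  apply: axis_antiS; lra.
by apply: axis_anti; lra.
Qed.

(** These two facts control [F] outside [Lam k]: they come from monotonicity of [f] under (alpha)
    and from enlarging [k] under (beta). *)
Hypothesis growth : forall x i, Cplus x -> F x 0 i <= F (axis i (x 0 i)) 0 i.
Hypothesis decay : forall i t e, 0 < e -> e <= k -> 1 + e <= t ->
  f (axis i t) 0 i <= f (axis i (1 + e)) 0 i.

Lemma kolmogorov_le (e : R) x i : 0 < e -> e <= k -> Cplus x ->
  F x 0 i <= Num.max (1 + e) (f (axis i (1 + e)) 0 i * x 0 i).
Proof.
move=> e0 ek x0; apply: le_trans (growth i x0) _; rewrite le_max; apply/orP.
have [xe|ex] := leP (x 0 i) (1 + e); [left|right].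
  apply: (@le_trans _ _ (F (axis i (1 + e)) 0 i)).
    by apply: axis_mono => //; rewrite ?x0// lerD2l.
  rewrite kolmogorovE axisE eqxx ger_pMr//; last by lra.
  by rewrite -[leRHS](f_axis1 i); apply: axis_anti; lra.
rewrite kolmogorovE axisE eqxx mulrC ler_wpM2r ?x0//.
by apply: decay => //; exact: ltW.
Qed.

Lemma Lam_F (e : R) x : 0 < e -> e <= k -> Lam e x -> Lam e (F x).
Proof.
move=> e0 ek /[dup] xL /LamP xe; have x0 := (Lam_Cplus xL).
apply/LamP => i; apply/andP; split; first exact: (kolmogorov_Cplus f_gt0 x0).
apply: le_trans (growth i x0) _.
have /andP[xi0 xi] := xe i.
apply: (@le_trans _ _ (F (axis i (1 + e)) 0 i)).
  by apply: axis_mono => //; rewrite lerD2l.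
rewrite kolmogorovE axisE eqxx ger_pMr//; last by lra.
by rewrite -[leRHS](f_axis1 i); apply: axis_anti; lra.
Qed.

(** By [kolmogorov_le] a coordinate is at most [1 + e] or shrinks by the factor [rho i < 1], so the
    time needed depends only on [M]. *)
Lemma Lam_absorbing (e M : R) : 0 < e -> e <= k -> exists N, forall n x, (N <= n)%N ->
  Cplus x -> (forall i, x 0 i <= M) -> Lam e (iter n F x).
Proof.
move=> e0 ek; pose rho i := f (axis i (1 + e)) 0 i.
have e1 : 0 <= 1 + e by lra.
have rho0 i : 0 < rho i by exact: (f_pos f_gt0 _ (axis_Cplus i e1)).
have rho1 i : rho i < 1.
  by rewrite -[ltRHS](f_axis1 i); apply: axis_antiS; lra.
suff ex i : exists N, forall n x, (N <= n)%N -> Cplus x -> x 0 i <= M -> iter n F x 0 i <= 1 + e.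
  have [N NP] := choice ex; exists (\max_i N i)%N => n x Nn x0 xM; apply/LamP => i.
  apply/andP; split; first exact: (iter_Cplus f_gt0).
  by apply: NP => //; apply: leq_trans Nn; exact: leq_bigmax.
have le n x : Cplus x -> iter n F x 0 i <= Num.max (1 + e) (rho i ^+ n * x 0 i).
  move=> x0; elim: n => [|n IH]; first by rewrite expr0 mul1r le_max lexx orbT.
  rewrite iterS; apply: le_trans (kolmogorov_le i e0 ek (iter_Cplus f_gt0 n x0)) _.
  rewrite ge_max le_max lexx /= -/(rho i); move: IH; rewrite !le_max => /orP[le|le]; apply/orP.
    left; apply: le_trans (_ : 1 * (1 + e) <= _); last by rewrite mul1r.
    by apply: ler_pM => //; [exact: ltW|exact: (iter_Cplus f_gt0)|exact: ltW].
  by right; rewrite exprS -mulrA ler_wpM2l// ltW.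
have r1 : `|rho i| < 1 by rewrite gtr0_norm.
have M0 : 0 < (`|M| + 1)^-1 by rewrite invr_gt0 ltr_wpDl.
have /cvgrPdist_lt/(_ _ M0)[N _ NP] := cvg_expr r1.
exists N => n x Nn x0 xM; apply: le_trans (le n x x0) _; rewrite ge_max lexx /=.
have := NP n Nn; rewrite /= sub0r normrN gtr0_norm ?exprn_gt0// => rn.
apply: (@le_trans _ _ ((`|M| + 1)^-1 * (`|M| + 1))).
  apply: ler_pM; rewrite ?x0//; [exact/ltW/exprn_gt0|exact: ltW|].
  by apply: (le_trans xM); rewrite (le_trans (ler_norm _))// lerDl.
by rewrite mulVf ?gt_eqF// ?ltr_wpDl// lerDl ltW.
Qed.

End InverseMonotone.

Lemma alpha_growth x i : condition_alpha f -> Cplus x -> F x 0 i <= F (axis i (x 0 i)) 0 i.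
Proof.
move=> [_ mono] x0; rewrite !kolmogorovE axisE eqxx ler_wpM2l ?x0//.
have /vleP[->//|lt] : vle (axis i (x 0 i)) x.
  by move=> j; rewrite axisE; case: eqP => [->//|_]; exact: x0.
by have [] := mono _ _ (axis_Cplus i (x0 i)) x0 lt.
Qed.

Lemma alpha_decay i (s t : R) : condition_alpha f -> 0 <= s -> s <= t ->
  f (axis i t) 0 i <= f (axis i s) 0 i.
Proof.
move=> [_ mono] s0 st; have t0 := le_trans s0 st.
have /vleP[->//|lt] : vle (axis i s) (axis i t).
  by move=> j; rewrite !axisE; case: eqP.
by have [] := mono _ _ (axis_Cplus i s0) (axis_Cplus i t0) lt.
Qed.

(** With [k] so large that [Lam k] contains [x], a failure would give [x i < x i] by strict inverse
    monotonicity. *)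
Lemma beta_growth x i : condition_beta f -> Cplus x -> F x 0 i <= F (axis i (x 0 i)) 0 i.
Proof.
move=> beta x0; pose k := 1 + \sum_j x 0 j.
have s0 : 0 <= \sum_j x 0 j by apply: sumr_ge0 => j _; exact: x0.
have k0 : 0 < k by rewrite ltr_pwDl.
have xk j : x 0 j <= 1 + k.
  have : x 0 j <= \sum_j x 0 j.
    by rewrite (bigD1 j)//= lerDl; apply: sumr_ge0 => l _; exact: x0.
  rewrite /k; lra.
have fk := beta_inverse_monotone beta k0.
rewrite leNgt; apply/negP => lt.
have := Lam_isoS fk (axis_Lam k0 i _) _ (kolmogorov_axis (ltW lt) x0) lt.
rewrite x0 xk axisE eqxx ltxx => /(_ isT) h; suff : false by []; apply: h.
by apply/LamP => j; rewrite x0 xk.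
Qed.

Lemma beta_decay i (s t : R) : condition_beta f -> 0 <= s -> s <= t ->
  f (axis i t) 0 i <= f (axis i s) 0 i.
Proof.
move=> beta s0 st; have k0 : 0 < 1 + t by rewrite ltr_pwDl// (le_trans s0).
apply: (axis_anti k0 (beta_inverse_monotone beta k0)) => //; lra.
Qed.

End Reduction.

Theorem theorem2p2 (R : realType) (d : nat) (d_gt0 : (0 < d)%N)
    (f : 'rV[R]_d -> 'rV[R]_d)
    (f_Cplus : set_fun Cplus Cplus f)
    (f_cont : {within Cplus, continuous f})
    (f_gt0 : forall x, Cplus x -> vll 0 (f x))
    (f_axis : forall i : 'I_d, f (delta_mx 0 i) 0 i = 1)
    (alpha_or_beta : condition_alpha f \/ condition_beta f) :
  exists Sig : set 'rV[R]_d,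
    [/\ weak_carrying_simplex (kolmogorov f) Sig,
        strengthening f -> carrying_simplex (kolmogorov f) Sig &
        forall Gam : set 'rV[R]_d, compact_attractor (kolmogorov f) Gam ->
        [/\
            [/\ Sig = rel_boundary Cplus Gam,
                order_convex Gam &
                Gam = [set z | exists a x,
                         [/\ 0 <= a <= 1, Sig x & z = a *: x]]],
            Gam `\` Sig = [set z | exists a x,
                             [/\ 0 <= a < 1, Sig x & z = a *: x]] /\
            Gam `\` Sig = [set x | Cplus x /\
                             exists2 u, backward_orbit (kolmogorov f) x u &
                                        u @ \oo --> (0 : 'rV[R]_d)],
            Sig = [set x | Cplus x /\
                     exists2 O, total_orbit (kolmogorov f) x O &
                                bounded_set O /\ bounded_away_from_0 O] &
            orth_proj_inv_lipschitz Sig]].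
Proof.
have [k k0 fk] : exists2 k, 0 < k & inverse_monotone f k.
  case: alpha_or_beta => h; first exact: alpha_inverse_monotone.
  by exists 1 => //; exact: beta_inverse_monotone.
have growth x i : Cplus x -> kolmogorov f x 0 i <= kolmogorov f (axis i (x 0 i)) 0 i.
  by case: alpha_or_beta => h; [exact: alpha_growth|exact: beta_growth].
have decay i (t e : R) : 0 < e -> e <= k -> 1 + e <= t ->
    f (axis i t) 0 i <= f (axis i (1 + e)) 0 i.
  move=> e0 _ et; have e1 : 0 <= 1 + e by lra.
  by case: alpha_or_beta => h; [exact: alpha_decay|exact: beta_decay].
(* Any side strictly between 1 and [1 + k] would do: above 1 the box absorbs orbits, below [1 + k]
   it leaves room for preimages. *)
pose b := 1 + k / 2.
have b0 : 0 < b by rewrite /b; lra.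
have bK : b < 1 + k by rewrite /b; lra.
have k20 : 0 < k / 2 by lra.
have k2k : k / 2 <= k by lra.
have inj := Lam_inj f_cont f_gt0 fk; have iso := Lam_iso f_cont f_gt0 fk.
have isoS := Lam_isoS fk; have anti := Lam_anti f_cont f_gt0 fk.
have antiS := Lam_antiS f_gt0 fk.
have FL x : vitv 0 (b *: ones) x -> vitv 0 (b *: ones) (kolmogorov f x).
  exact: (Lam_F f_cont f_gt0 f_axis k0 fk growth k20 k2k).
have f01 := f0_gt1 f_cont f_gt0 f_axis k0 fk.
have absorb := Lam_absorbing f_cont f_gt0 f_axis k0 fk growth decay.
have abs M := absorb (k / 2) M k20 k2k.
have [del sdel] := ex_small f_cont b0 f01.
exists (Sig f b del); split.
- exact: (Sig_weak_carrying_simplex f_cont f_gt0 b0 bK inj iso isoS anti antiS FL sdel abs).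
- move=> str.
  apply: (Sig_carrying_simplex f_cont f_gt0 b0 bK inj iso isoS anti antiS FL sdel abs).
  apply: (Sig_unordered f_cont f_gt0 b0 bK inj iso isoS anti antiS FL sdel).
  case: str => [[k' k'0 [_ rt]]|]; last by right.
  (* Retrotonicity is given on [Lam k'] only; [Gam] lies in every image of [L], and absorption into
     the smaller of the two boxes places it there. *)
  have kk'0 : 0 < Num.min k k' by rewrite lt_min k0.
  have kk'k : Num.min k k' <= k by rewrite ge_min lexx.
  have [N NP] := absorb _ b kk'0 kk'k.
  suff GL x : Gam f b x -> Lam k' x by left=> x y /GL xL /GL yL; exact: rt.
  move=> /(_ N)[y /boxP yb <-].
  have /LamP xL : Lam (Num.min k k') (iter N (kolmogorov f) y).
    by apply: NP => // i; case/andP: (yb i).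
  apply/LamP => i; have /andP[-> /le_trans->//] := xL i.
  by rewrite lerD2l ge_min lexx orbT.
- exact: (core_conclusion f_cont f_gt0 b0 bK inj iso isoS anti antiS FL sdel abs d_gt0).
Qed.
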